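(* Let $\{\mathrm P_N\}$ be a sequence of priors as described in the context, and suppose that, for independent draws $\mathbf X,\mathbf X'$ from $\mathrm P_N$, $$\lim_{t\to 1^-}\limsup_{N\to\infty}\frac{1}{\log M_N}\log \mathrm P_N^{\otimes 2}\left[\langle \mathbf X,\mathbf X'\rangle\ge t\right]\le -1 .$$ Then there exists a sequence $\{\lambda_N\}$ of positive reals such that $\{\mathrm P_N\}$ satisfies the all-or-nothing phenomenon with critical SNR $\{\lambda_N\}$ if and only if $$D\left(\mathrm Q_{2\log M_N,\,N}\,\|\,\mathrm Q_{0,N}\right)=o(\log M_N)\quad\text{as } N\to\infty .$$ Moreover, in this situation, one can take $\lambda_N=2\log M_N$, i.e. $\{\mathrm P_N\}$ satisfies the all-or-nothing phenomenon with critical SNR $\{2\log M_N\}$.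
   Context: Gaussian additive model: for each $N$, $\mathrm P_N$ is the uniform distribution on a finite subset of the unit sphere of $\mathbb R^N$; the cardinality of this subset is $M_N$, and $M_N\to\infty$ as $N\to\infty$. For $\lambda\ge 0$ one observes $\mathbf Y=\sqrt{\lambda}\,\mathbf X+\mathbf Z$, where $\mathbf X\sim \mathrm P_N$ and $\mathbf Z\in\mathbb R^N$ has i.i.d. standard Gaussian entries and is independent of $\mathbf X$. $\mathrm Q_{\lambda,N}$ denotes the law of $\mathbf Y$ (so $\mathrm Q_{0,N}$ is the standard Gaussian law on $\mathbb R^N$). $D(\mathrm P_1\|\mathrm P_2)=\mathbb E_{\mathrm P_2}\left[\frac{d\mathrm P_1}{d\mathrm P_2}\log\frac{d\mathrm P_1}{d\mathrm P_2}\right]$ is the Kullback-Leibler divergence. $\mathrm P_N^{\otimes 2}$ is the law of an independent pair. Define $\mathrm{MMSE}_N(\lambda)=\mathbb E\|\mathbf X-\mathbb E[\mathbf X\mid\mathbf Y]\|^2$. The sequence $\{\mathrm P_N\}$ satisfies the all-or-nothing phenomenon with critical SNR $\{\lambda_N\}$ (a sequence of positive reals) if for every fixed $\beta\ge 0$ with $\beta\neq 1$, $\lim_{N\to\infty}\mathrm{MMSE}_N(\beta\lambda_N)$ equals $1$ if $\beta<1$ and $0$ if $\beta>1$. *)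

(* Defs.v *)
From HB Require Import structures.
From mathcomp Require Import all_boot all_order all_algebra finmap.
From mathcomp Require Import all_classical all_reals all_analysis measurable_realfun.

Set Implicit Arguments.
Unset Strict Implicit.
Unset Printing Implicit Defensive.

Import Order.TTheory GRing.Theory Num.Theory.
Import numFieldNormedType.Exports.

Local Open Scope classical_set_scope.
Local Open Scope charge_scope.
Local Open Scope ring_scope.

(* Vectors of R^N are N.-tuple R, the library's type carrying the product Borel
   sigma-algebra. *)
Definition dotp (R : realType) (N : nat) (x y : N.-tuple R) : R :=
  \sum_(i < N) tnth x i * tnth y i.

Section divergence_and_mmse.
Context {R : realType}.

(* D(P1 || P2) = E_P2[dP1/dP2 log (dP1/dP2)]; meaningful when P1 `<< P2.
   Here lne 0 = -oo and 0 * -oo = 0. *)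
Definition KL d (T : measurableType d) (P1 P2 : probability T R) : \bar R :=
  let f := 'd (charge_of_finite_measure P1) '/d P2 in
  (\int[P2]_x (f x * lne (f x)))%E.

(* g is a version of E[X | Y], i.e. of E[X | sigma(Y)]. *)
Definition is_cond_exp d d' (T : measurableType d) (U : measurableType d')
    (P : probability T R) (Y : T -> U) (X g : T -> R) : Prop :=
  [/\ measurable_fun [set: g_sigma_algebra_preimageType Y]
        (g : g_sigma_algebra_preimageType Y -> R),
      P.-integrable [set: T] (EFin \o g) &
      forall A, g_sigma_algebra_preimage Y A ->
        (\int[P]_(w in A) (g w)%:E = \int[P]_(w in A) (X w)%:E)%E].

Definition cond_exp d d' (T : measurableType d) (U : measurableType d')
    (P : probability T R) (Y : T -> U) (X : T -> R) : T -> R :=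
  xget (cst 0) [set g | is_cond_exp P Y X g].

(* E[X | Y] is taken coordinatewise. *)
Definition mmse d d' (T : measurableType d) (U : measurableType d')
    (P : probability T R) (N : nat) (X : T -> N.-tuple R) (Y : T -> U) : \bar R :=
  'E_P[fun w => \sum_(i < N)
         (tnth (X w) i - cond_exp P Y (fun v => tnth (X v) i) w) ^+ 2].

End divergence_and_mmse.

Section uniform_law.
Context {R : realType} {N : nat}.
Implicit Type S : {fset N.-tuple R}.

Local Notation x0 := (nseq_tuple N 0 : N.-tuple R).

(* The Dirac mass at 0 is only a default, taken when S is empty (unavoidable on
   the unit sphere of R^0); see uniform_lawE. *)
Definition uniform_law S : probability (N.-tuple R) R :=
  mnormalize (msum (fun k => \d_(nth x0 S k)) #|` S|) \d_x0.

Lemma uniform_lawE S (A : set (N.-tuple R)) : S != fset0 ->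
  uniform_law S A = ((\sum_(x <- S) \1_A x) / #|` S|%:R)%:E.
Proof.
move=> S0.
have sumT : \sum_(x <- S) \1_[set: N.-tuple R] x = #|` S|%:R :> R.
  under eq_bigr do rewrite indicT.
  by rewrite big_const_seq count_predT iter_addr_0.
rewrite /uniform_law /= /mnormalize /=; set m := msum _ _.
have mE B : m B = (\sum_(x <- S) \1_B x)%:E.
  by rewrite /m /msum sumEFin (big_nth x0) big_mkord.
rewrite !mE sumT /= ifF ?mE ?EFinM//.
by apply/negbTE; rewrite orbF eqe pnatr_eq0 cardfs_eq0.
Qed.

End uniform_law.

Section gaussian_model.
Context {R : realType}.

(* normal_prob lives on measurableTypeR R, a copy of R with the same measurable
   sets. *)
Definition cons_pair (N : nat) (u : measurableTypeR R * N.-tuple R) :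
    N.+1.-tuple R :=
  cons_tuple (u.1 : R) u.2.

Lemma measurable_cons_pair N :
  measurable_fun [set: measurableTypeR R * N.-tuple R] (@cons_pair N).
Proof.
apply: (@measurable_cons _ _ _ _
  (fun u : measurableTypeR R * N.-tuple R => u.1 : R) N (fun u => u.2)).
  exact: measurable_fst.
exact: measurable_snd.
Qed.

HB.instance Definition _ N :=
  isMeasurableFun.Build _ _ _ _ (@cons_pair N) (@measurable_cons_pair N).

(* The law of N i.i.d. standard Gaussian variables. *)
Fixpoint gaussian_law (N : nat) : probability (N.-tuple R) R :=
  if N is N'.+1 then
    distribution (normal_prob 0 1 \x gaussian_law N')%E (@cons_pair N')
  else \d_([tuple]).

Lemma gaussian_lawE N (A : 'I_N -> set R) : (forall i, measurable (A i)) ->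
  gaussian_law N [set z | forall i, A i (tnth z i)] =
  (\prod_(i < N) normal_prob 0 1 (A i))%E.
Proof.
elim: N A => [|N IH] A mA.
  rewrite big_ord0 /= diracE mem_set//; by case.
rewrite big_ord_recl -(IH (fun i => A (lift ord0 i)))//=.
have mB : measurable [set z : N.-tuple R | forall i, A (lift ord0 i) (tnth z i)].
  rewrite (_ : mkset _ =
      \bigcap_(i in [set: 'I_N]) ((fun z => tnth z i) @^-1` A (lift ord0 i))).
    apply: fin_bigcap_measurable => // i _.
    by rewrite -[X in measurable X]setTI; exact: measurable_tnth.
  by apply/seteqP; split => z /= h i; [move=> _|]; exact: h.
rewrite -product_measure1E//=; last exact: mA.
congr (_ _); apply/seteqP; split => -[x z] /=.
  move=> h; split=> [|i]; first exact: (h ord0).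
  by have := h (lift ord0 i); rewrite tnthS.
move=> [Ax Az] i; case: (unliftP ord0 i) => [j|] ->//.
by rewrite tnthS.
Qed.

Definition observation (N : nat) (lambda : R) (xz : N.-tuple R * N.-tuple R)
    : N.-tuple R :=
  [tuple Num.sqrt lambda * tnth xz.1 i + tnth xz.2 i | i < N].

Lemma measurable_observation N lambda : measurable_fun
  [set: N.-tuple R * N.-tuple R] (@observation N lambda).
Proof.
apply/measurable_fun_tnthP => i.
rewrite (_ : _ \o _ = fun xz => Num.sqrt lambda * tnth xz.1 i + tnth xz.2 i).
  apply: measurable_funD.
    apply: measurable_funM => //.
    exact: (measurableT_comp (measurable_tnth i) measurable_fst).
  exact: (measurableT_comp (measurable_tnth i) measurable_snd).
by apply/funext => xz /=; rewrite tnth_mktuple.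
Qed.

HB.instance Definition _ N lambda := isMeasurableFun.Build _ _ _ _
  (@observation N lambda) (@measurable_observation N lambda).

(* The joint law of (X, Z). *)
Definition signal_noise_law N (S : {fset N.-tuple R}) :
  probability (N.-tuple R * N.-tuple R)%type R :=
  (uniform_law S \x gaussian_law N)%E.

(* Q_(lambda, N), the law of Y = sqrt lambda X + Z. *)
Definition observation_law N (S : {fset N.-tuple R}) (lambda : R) :
  probability (N.-tuple R) R :=
  distribution (signal_noise_law S) (@observation N lambda).

Definition gaussian_mmse N (S : {fset N.-tuple R}) (lambda : R) : \bar R :=
  mmse (signal_noise_law S) fst (@observation N lambda).

(* "Positive" is only asked eventually: a prior with one atom, which the growth
   of the number of atoms allows for finitely many N, makes 2 log M_N vanish. *)
Definition all_or_nothing (S : forall N, {fset N.-tuple R}) (lambda : R^nat) :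
    Prop :=
  [/\ \forall N \near \oo, 0 < lambda N,
      forall beta, 0 <= beta < 1 ->
        gaussian_mmse (S N) (beta * lambda N) @[N --> \oo] --> 1%E &
      forall beta, 1 < beta ->
        gaussian_mmse (S N) (beta * lambda N) @[N --> \oo] --> 0%E].

End gaussian_model.

(* Main.v *)
Require Import Defs.
From HB Require Import structures.
From mathcomp Require Import all_boot all_order all_algebra finmap.
From mathcomp Require Import all_classical all_reals all_analysis measurable_realfun.
From mathcomp Require Import ring lra.

Set Implicit Arguments.
Unset Strict Implicit.
Unset Printing Implicit Defensive.

Import Order.TTheory GRing.Theory Num.Theory.
Import numFieldNormedType.Exports.

Local Open Scope classical_set_scope.
Local Open Scope ring_scope.

(** Write L for the logarithm of the number of atoms and s for the square root
    of the signal-to-noise ratio. With unit-norm atoms x, the observation has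
    density

      lik s y = average over x of exp (s x.y - s^2 / 2)

    with respect to the Gaussian law, so the divergence from pure noise is
    G s = E [lik s ln (lik s)] (KL_observation_law), while the mean square
    error is 1 - q s, where q s is the mean squared norm of the posterior mean
    (gaussian_mmseE).

    Everything rests on one inequality, rel_entropy_subgradient: for all real
    s and t,

      s (t - s) q s <= G t - G s.

    It says that s q s is a subgradient of G at s, and plays the part of the
    identity between the derivative of mutual information and the mean square
    error. No derivative is taken: Gibbs' inequality bounds G t from below by
    the expectation of ln (lik s) under the observation law of parameter t, a
    Cameron-Martin shift turns the difference with G s into increments of
    ln (lik s) along the signal, and ln (lik s), a log-sum-exp, is convex with
    gradient s times the posterior mean. Since 0 <= q <= 1, refining a
    subdivision also gives G t - G s <= (t^2 - s^2) / 2 for 0 <= s <= t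
    (rel_entropy_increment). Finally G s >= s^2 / 2 - L (rel_entropy_ge),
    because mutual information is at most L.

    Suppose that G u = o(L) at u^2 = 2 L. Below the threshold, the subgradient
    inequality between b u and u makes q (b u) vanish (sqmean_le_rel_entropy).
    Above it, G (b u) - G (r u) is at least (b^2 - r^2) L - o(L) for
    1 <= r < b, and the subgradient inequality turns this into a lower bound
    on q (b u) which tends to 1 as r tends to b (sqmean_ge_rel_entropy).

    Conversely, let the phenomenon hold with critical values lambda = u^2.
    Since q (b u) vanishes for b < 1, G (b u) is at most a small multiple of
    u^2 for b slightly above 1 (rel_entropy_le_sqmean), and then
    G >= s^2 / 2 - L gives u^2 = O(L). It remains to see that 2 L is at most
    (1 + o(1)) u^2, for then monotonicity of G gives G = o(L) at 2 L. This is
    where the overlap hypothesis enters, through a Fano-type inequality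
    (rel_entropy_fano): once the mean square error is small, an independent
    draw from the posterior is close to the signal, so the signal is known up
    to a ball, and on average such a ball contains only few atoms. Hence the
    conditional entropy of the signal is o(L), and its mutual information with
    the observation, at most half the signal-to-noise ratio, is at least
    L - o(L). *)

(** * The Gaussian law under translation *)

Lemma ge0_integral_lebesgue_translate (R : realType) (h : R)
    (f : measurableTypeR R -> \bar R) :
  measurable_fun [set: measurableTypeR R] f -> (forall x, 0 <= f x)%E ->
  (\int[lebesgue_measure]_x f (x + h)%R = \int[lebesgue_measure]_x f x)%E.
Proof.
move=> mf f0.
pose phi (x : measurableTypeR R) : measurableTypeR R := x + h.
have mphi : measurable_fun [set: measurableTypeR R] phi by exact: measurable_funD.
rewrite -[LHS](@ge0_integral_pushforward _ _ (measurableTypeR R)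
  (measurableTypeR R) R phi mphi lebesgue_measure setT f)//.
apply: eq_measure_integral => A mA _.
apply/esym.
apply: (@lebesgue_measure_unique R (pushforward lebesgue_measure phi)) => //.
move=> X [[a b] _ <-].
rewrite /pushforward /=.
rewrite [X in _ = lebesgue_measure X](_ : _ = `]a - h, b - h]%classic).
  2: by apply/seteqP; split => x; rewrite /phi/= !in_itv/= ltrBlDr lerBrDr.
rewrite !lebesgue_measure_itv/= !lte_fin ltrD2r; case: ifPn => // _.
by rewrite -!EFinB; congr EFin; ring.
Qed.

(** The density is recovered from the abstract Radon-Nikodym derivative, for
    which change of variables is available; the two agree almost everywhere. *)
Lemma ge0_integral_normal_prob (R : realType) (m s : R)
    (f : measurableTypeR R -> \bar R) :
  measurable_fun [set: measurableTypeR R] f -> (forall x, 0 <= f x)%E ->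
  (\int[normal_prob m s]_x f x =
   \int[lebesgue_measure]_x (f x * (normal_pdf m s x)%:E))%E.
Proof.
move=> mf f0.
have dom := @normal_prob_dominates R m s.
rewrite -(Radon_Nikodym_SigmaFinite.change_of_variables dom)//.
have mpdf : measurable_fun [set: measurableTypeR R]
    (fun x : measurableTypeR R => (normal_pdf m s x)%:E).
  by apply/measurable_EFinP; exact: measurable_normal_pdf.
have iRN := Radon_Nikodym_SigmaFinite.f_integrable dom.
apply: ae_eq_integral => //.
- by apply: emeasurable_funM => //; exact: measurable_int iRN.
- exact: emeasurable_funM.
apply: ae_eqe_mul2l; apply: integral_ae_eq => // A _ mA.
by rewrite -Radon_Nikodym_SigmaFinite.f_integral.
Qed.

(** Completing the square: the Gaussian density at y - h is the density at y
    times exp (h y - h^2 / 2). *)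
Lemma ge0_normal_prob_shift (R : realType) (h : R)
    (f : measurableTypeR R -> \bar R) :
  measurable_fun [set: measurableTypeR R] f -> (forall x, 0 <= f x)%E ->
  (\int[normal_prob 0 1]_z f (z + h)%R =
   \int[normal_prob 0 1]_y (f y * (expR (h * y - h ^+ 2 / 2))%:E))%E.
Proof.
move=> mf f0.
have mpdf (m s : R) : measurable_fun [set: measurableTypeR R]
    (fun x : measurableTypeR R => (normal_pdf m s x)%:E).
  by apply/measurable_EFinP; exact: measurable_normal_pdf.
have pdf0 (m s x : R) : (0 <= (normal_pdf m s x)%:E)%E.
  by rewrite lee_fin normal_pdf_ge0.
have mfh : measurable_fun [set: measurableTypeR R] (fun z : measurableTypeR R => f (z + h)).
  by apply: (measurableT_comp mf); exact: measurable_funD.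
have mexp : measurable_fun [set: measurableTypeR R]
    (fun y : measurableTypeR R => (expR (h * y - h ^+ 2 / 2))%:E).
  apply/measurable_EFinP; apply: measurableT_comp => //.
  by apply: measurable_funB => //; exact: measurable_funM.
rewrite !ge0_integral_normal_prob//; last 2 first.
- exact: emeasurable_funM.
- by move=> x; rewrite mule_ge0// lee_fin expR_ge0.
rewrite -[RHS](ge0_integral_lebesgue_translate h); last 2 first.
- by apply: emeasurable_funM => //; exact: emeasurable_funM.
- by move=> x; rewrite !mule_ge0// lee_fin expR_ge0.
apply: eq_integral => x _; rewrite -muleA -EFinM; congr (_ * _%:E)%E.
rewrite !normal_pdfE ?oner_neq0// /normal_fun !subr0 mulrCA -expRD.
congr (_ * expR _).
by field.
Qed.

Definition shift_tuple (R : realType) (N : nat) (s : R) (x z : N.-tuple R) :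
    N.-tuple R :=
  [tuple s * tnth x i + tnth z i | i < N].

Lemma measurable_shift_tuple (R : realType) (N : nat) (s : R) (x : N.-tuple R) :
  measurable_fun [set: N.-tuple R] (shift_tuple s x).
Proof.
apply/measurable_fun_tnthP => i.
rewrite (_ : _ \o _ = fun z => s * tnth x i + tnth z i).
  by apply: measurable_funD => //; exact: measurable_tnth.
by apply/funext => z /=; rewrite tnth_mktuple.
Qed.

Lemma measurable_dotp (R : realType) (N : nat) (x : N.-tuple R) :
  measurable_fun [set: N.-tuple R] (dotp x).
Proof.
apply: measurable_sum => i; apply: measurable_funM => //.
exact: measurable_tnth.
Qed.

Lemma dotp_cons (R : realType) (N : nat) (a b : R) (x y : N.-tuple R) :
  dotp [tuple of a :: x] [tuple of b :: y] = a * b + dotp x y.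
Proof.
by rewrite /dotp big_ord_recl !tnth0; congr (_ + _); apply: eq_bigr => i _; rewrite !tnthS.
Qed.

Lemma shift_tuple_cons (R : realType) (N : nat) (s a b : R) (x z : N.-tuple R) :
  shift_tuple s [tuple of a :: x] [tuple of b :: z] =
  [tuple of (s * a + b) :: shift_tuple s x z].
Proof.
apply: eq_from_tnth => i; rewrite tnth_mktuple.
by case: (unliftP ord0 i) => [j|] ->; rewrite ?tnthS ?tnth0// tnth_mktuple.
Qed.

Lemma ge0_integral_gaussian_lawS (R : realType) (N : nat)
    (f : N.+1.-tuple R -> \bar R) :
  measurable_fun [set: N.+1.-tuple R] f -> (forall y, 0 <= f y)%E ->
  (\int[gaussian_law N.+1]_y f y =
   \int[normal_prob 0 1]_a \int[gaussian_law N]_u f [tuple of a :: u])%E.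
Proof.
move=> mf f0.
rewrite [LHS](@ge0_integral_pushforward _ _ _ _ R _ (@measurable_cons_pair R N)
  (normal_prob 0 1 \x gaussian_law N)%E setT f)//.
rewrite preimage_setT fubini_tonelli1//=.
by apply: measurableT_comp => //; exact: measurable_cons_pair.
Qed.

Lemma measurable_gaussian_section (R : realType) (N : nat)
    (f : N.+1.-tuple R -> \bar R) :
  measurable_fun [set: N.+1.-tuple R] f -> (forall y, 0 <= f y)%E ->
  measurable_fun [set: measurableTypeR R]
    (fun a : measurableTypeR R => \int[gaussian_law N]_u f [tuple of (a : R) :: u])%E.
Proof.
move=> mf f0.
apply: (@measurable_fun_fubini_tonelli_F _ _ _ _ _ (gaussian_law N) (f \o @cons_pair R N)) => //.
  by apply: measurableT_comp => //; exact: measurable_cons_pair.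
by move=> u; exact: f0.
Qed.

Lemma measurable_cons_tuple (R : realType) (N : nat) (a : R) :
  measurable_fun [set: N.-tuple R] (fun u : N.-tuple R => [tuple of a :: u]).
Proof. by apply: (@measurable_cons _ _ _ _ (cst a)). Qed.

(** A signal s x added to the noise amounts to reweighting the noise by an
    exponential. The first coordinate is shifted by the one-dimensional
    formula, the remaining ones by induction. *)
Theorem ge0_cameron_martin (R : realType) (N : nat) (s : R) (x : N.-tuple R)
    (f : N.-tuple R -> \bar R) :
  measurable_fun [set: N.-tuple R] f -> (forall y, 0 <= f y)%E ->
  (\int[gaussian_law N]_z f (shift_tuple s x z) =
   \int[gaussian_law N]_y
     (f y * (expR (s * dotp x y - s ^+ 2 / 2 * dotp x x))%:E))%E.
Proof.
elim: N x f => [|N IH] x f mf f0.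
  apply: eq_integral => y _.
  rewrite (tuple0 (shift_tuple s x y)) (tuple0 y) /dotp !big_ord0 !mulr0 subr0.
  by rewrite expR0 mule1.
case/tupleP: x => a x.
have mE n (v : n.-tuple R) : measurable_fun [set: n.-tuple R]
    (fun y => (expR (s * dotp v y - s ^+ 2 / 2 * dotp v v))%:E).
  apply/measurable_EFinP; apply: measurableT_comp => //.
  by apply: measurable_funB => //; apply: measurable_funM => //; exact: measurable_dotp.
have mfc b : measurable_fun [set: N.-tuple R] (fun u : N.-tuple R => f [tuple of b :: u]).
  by apply: (measurableT_comp mf); exact: measurable_cons_tuple.
rewrite ge0_integral_gaussian_lawS//; last first.
  by apply: (measurableT_comp mf); exact: measurable_shift_tuple.
rewrite ge0_integral_gaussian_lawS; last 2 first.
- by apply: emeasurable_funM => //; exact: mE.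
- by move=> y; rewrite mule_ge0// lee_fin expR_ge0.
pose g (y : N.+1.-tuple R) := (f y * (expR (s * dotp x [tuple of behead y]
  - s ^+ 2 / 2 * dotp x x))%:E)%E.
have mg : measurable_fun [set: N.+1.-tuple R] g.
  apply: emeasurable_funM => //; apply: (measurableT_comp (mE _ _)).
  apply/measurable_fun_tnthP => i.
  rewrite (_ : _ \o _ = fun y : N.+1.-tuple R => tnth y (lift ord0 i)).
    exact: measurable_tnth.
  by apply/funext => y /=; case/tupleP: y => b y; rewrite tnthS !(tnth_nth 0).
have g0 y : (0 <= g y)%E by rewrite mule_ge0// lee_fin expR_ge0.
pose F (b : measurableTypeR R) := (\int[gaussian_law N]_u g [tuple of (b : R) :: u])%E.
have behead_cons b (u : N.-tuple R) : [tuple of behead [tuple of b :: u]] = u.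
  exact: val_inj.
transitivity (\int[normal_prob 0 1]_b F (b + s * a)%R)%E.
  apply: eq_integral => b _.
  under eq_integral do rewrite shift_tuple_cons (addrC _ b).
  apply: etrans (IH x (fun u => f [tuple of b + s * a :: u]) (mfc _) (fun=> f0 _)) _.
  by apply: eq_integral => u _; rewrite /g behead_cons.
have F0 b : (0 <= F b)%E by apply: integral_ge0 => u _; exact: g0.
have mF := measurable_gaussian_section mg g0.
rewrite (ge0_normal_prob_shift (s * a) mF F0).
apply: eq_integral => b _; rewrite -ge0_integralZr//; last first.
  by apply: (measurableT_comp mg); exact: measurable_cons_tuple.
apply: eq_integral => u _; rewrite /g behead_cons -muleA -EFinM -expRD.
by rewrite !dotp_cons; congr (_ * (expR _)%:E)%E; field.
Qed.

Definition norm1 (R : realType) (N : nat) (y : N.-tuple R) : R :=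
  \sum_(i < N) `|tnth y i|.

Lemma norm1_ge0 (R : realType) (N : nat) (y : N.-tuple R) : 0 <= norm1 y.
Proof. exact: sumr_ge0. Qed.

Lemma measurable_norm1 (R : realType) (N : nat) :
  measurable_fun [set: N.-tuple R] (@norm1 R N).
Proof.
apply: measurable_sum => i; apply: measurableT_comp => //.
exact: measurable_tnth.
Qed.

Lemma norm1_cons (R : realType) (N : nat) (a : R) (y : N.-tuple R) :
  norm1 [tuple of a :: y] = `|a| + norm1 y.
Proof.
by rewrite /norm1 big_ord_recl tnth0; congr (_ + _); apply: eq_bigr => i _; rewrite tnthS.
Qed.

Lemma normal_prob_mgf (R : realType) (h : R) :
  (\int[normal_prob 0 1]_y (expR (h * y))%:E = (expR (h ^+ 2 / 2))%:E)%E.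
Proof.
have /esym := ge0_normal_prob_shift h (measurable_cst 1%E) (fun=> @lee01 R).
rewrite [X in _ = X](_ : _ = 1%E) /=; last first.
  rewrite (integral_cst (normal_prob (0 : R) 1))// mul1e.
  exact: (@probability_setT _ _ _ (normal_prob (0 : R) 1)).
under eq_integral do rewrite mul1e expRD EFinM.
rewrite ge0_integralZr//; last first.
  by apply/measurable_EFinP; apply: measurableT_comp => //; exact: measurable_funM.
move=> /(congr1 (fun a => a * (expR (h ^+ 2 / 2))%:E)%E).
by rewrite -muleA -EFinM -expRD addNr expR0 mule1 mul1e => ->.
Qed.

(** This is the only integrability estimate: every integrand met later is
    dominated by such an exponential. *)
Lemma gaussian_exp_norm1_lty (R : realType) (N : nat) (k : R) : 0 <= k ->
  (\int[gaussian_law N]_y (expR (k * norm1 y))%:E < +oo)%E.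
Proof.
move=> k0.
have mE n : measurable_fun [set: n.-tuple R] (fun y => (expR (k * norm1 y))%:E).
  apply/measurable_EFinP; apply: measurableT_comp => //.
  by apply: measurable_funM => //; exact: measurable_norm1.
elim: N => [|N IH].
  under eq_integral do rewrite /norm1 big_ord0 mulr0 expR0.
  rewrite (integral_cst (@gaussian_law R 0))// mul1e.
  exact: (le_lt_trans (@probability_le1 _ _ R (@gaussian_law R 0) setT
    measurableT) (ltry 1)).
have mX (h : R) : measurable_fun [set: measurableTypeR R]
    (fun b : measurableTypeR R => (expR (h * b))%:E).
  by apply/measurable_EFinP; apply: measurableT_comp => //; exact: measurable_funM.
rewrite ge0_integral_gaussian_lawS//.
set c := (\int[gaussian_law N]_y (expR (k * norm1 y))%:E)%E in IH *.
have c0 : (0 <= c)%E by apply: integral_ge0 => y _; rewrite lee_fin expR_ge0.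
have -> : (\int[normal_prob 0 1]_a \int[gaussian_law N]_u
      (expR (k * norm1 [tuple of a :: u]))%:E)%E =
   (\int[normal_prob 0 1]_a ((expR (k * `|a|))%:E * c))%E.
  apply: eq_integral => a _; rewrite /c -ge0_integralZl//; last exact: mE.
  by apply: eq_integral => u _; rewrite norm1_cons mulrDr expRD EFinM.
have mA : measurable_fun [set: measurableTypeR R]
    (fun b : measurableTypeR R => (expR (k * `|b : R|))%:E).
  apply/measurable_EFinP; apply: measurableT_comp => //; exact: measurable_funM.
rewrite ge0_integralZr//.
apply: lte_mul_pinfty => //.
  by apply: integral_ge0 => y _; rewrite lee_fin expR_ge0.
rewrite ge0_fin_numE; last by apply: integral_ge0 => y _; rewrite lee_fin expR_ge0.
apply: (@le_lt_trans _ _ (\int[normal_prob 0 1]_a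
   ((expR (k * a))%:E + (expR (- k * a))%:E))%E).
  apply: ge0_le_integral => //.
  - by apply: emeasurable_funD => //; exact: mX.
  - move=> a _; rewrite -EFinD lee_fin; case: (ger0P a) => _.
      by rewrite lerDl expR_ge0.
    by rewrite mulrN mulNr lerDr expR_ge0.
rewrite ge0_integralD//; [|exact: mX..].
by rewrite !normal_prob_mgf ltry.
Qed.

(** * Functions of exponential growth and their Gaussian expectation *)

Section tame.
Context {R : realType} {N : nat}.
Implicit Types f g : N.-tuple R -> R.

(** Measurable functions of at most exponential growth. They form an algebra,
    stable under translations, of Gaussian-integrable functions that contains
    all the integrands needed, so that integrability becomes a syntactic
    matter. *)
Definition tame f :=
  measurable_fun setT f /\
  exists C k, [/\ 0 <= C, 0 <= k & forall y, `|f y| <= C * expR (k * norm1 y)].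

Lemma tame_integrable f : tame f ->
  (gaussian_law N).-integrable setT (EFin \o f).
Proof.
move=> [mf [C [k [C0 k0 fCk]]]].
apply: (@le_integrable _ _ _ _ _ _ _ (fun y => (C * expR (k * norm1 y))%:E)) => //.
- exact/measurable_EFinP.
- move=> y _ /=; rewrite lee_fin [leRHS]ger0_norm//.
  by rewrite mulr_ge0// expR_ge0.
under eq_fun do rewrite EFinM.
apply: integrableZl => //; apply/integrableP; split.
  apply/measurable_EFinP; apply: measurableT_comp => //.
  by apply: measurable_funM => //; exact: measurable_norm1.
under eq_integral => y _ do rewrite /= ger0_norm ?expR_ge0//.
exact: gaussian_exp_norm1_lty.
Qed.

Lemma tame_bounded f (C : R) : measurable_fun setT f ->
  (forall y, `|f y| <= C) -> tame f.
Proof.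
move=> mf fC; split => //; exists C, 0; split => //.
  exact: le_trans (normr_ge0 (f (nseq_tuple N 0))) (fC _).
by move=> y; rewrite mul0r expR0 mulr1.
Qed.

Lemma tame_cst (c : R) : tame (cst c).
Proof. by apply: (@tame_bounded _ `|c|) => // y. Qed.

Lemma tameD f g : tame f -> tame g -> tame (fun y => f y + g y).
Proof.
move=> [mf [C [k [C0 k0 fC]]]] [mg [D [l [D0 l0 gD]]]].
split; first exact: measurable_funD.
exists (C + D), (k + l); split; rewrite ?addr_ge0// => y.
rewrite mulrDl (le_trans (ler_normD _ _))// lerD//.
  by rewrite (le_trans (fC y))// ler_wpM2l// ler_expR ler_wpM2r ?norm1_ge0// lerDl.
by rewrite (le_trans (gD y))// ler_wpM2l// ler_expR ler_wpM2r ?norm1_ge0// lerDr.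
Qed.

Lemma tameM f g : tame f -> tame g -> tame (fun y => f y * g y).
Proof.
move=> [mf [C [k [C0 k0 fC]]]] [mg [D [l [D0 l0 gD]]]].
split; first exact: measurable_funM.
exists (C * D), (k + l); split; rewrite ?addr_ge0 ?mulr_ge0// => y.
by rewrite normrM mulrDl expRD mulrACA ler_pM.
Qed.

Lemma tameN f : tame f -> tame (fun y => - f y).
Proof.
move=> tf; rewrite (_ : (fun _ => _) = (fun y => cst (-1) y * f y)).
  by apply: tameM => //; exact: tame_cst.
by apply/funext => y; rewrite /= mulN1r.
Qed.

Lemma tameB f g : tame f -> tame g -> tame (fun y => f y - g y).
Proof. by move=> tf tg; apply: tameD => //; exact: tameN. Qed.

Lemma tameZ (c : R) f : tame f -> tame (fun y => c * f y).
Proof. by move=> tf; apply: (tameM (tame_cst c)). Qed.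

Lemma tame_sum (I : eqType) (r : seq I) (F : I -> N.-tuple R -> R) :
  (forall i, i \in r -> tame (F i)) -> tame (fun y => \sum_(i <- r) F i y).
Proof.
elim: r => [|i r IH] tF.
  by under eq_fun do rewrite big_nil; exact: tame_cst.
under eq_fun do rewrite big_cons.
apply: tameD; first by apply: tF; rewrite mem_head.
by apply: IH => j jr; apply: tF; rewrite inE jr orbT.
Qed.

Lemma norm_dotp_le (x y : N.-tuple R) : `|dotp x y| <= norm1 x * norm1 y.
Proof.
rewrite (le_trans (ler_norm_sum _ _ _))// /norm1 mulr_suml ler_sum// => i _.
rewrite normrM ler_wpM2l// (bigD1 i)//= lerDl sumr_ge0//.
Qed.

Lemma tame_dotp (x : N.-tuple R) : tame (dotp x).
Proof.
split; first exact: measurable_dotp.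
exists (norm1 x), 1; split => //; first exact: norm1_ge0.
move=> y; rewrite (le_trans (norm_dotp_le x y))// ler_wpM2l ?norm1_ge0// mul1r.
by rewrite (le_trans _ (expR_ge1Dx _))// lerDr.
Qed.

Lemma tame_expR_dotp (s c : R) (x : N.-tuple R) :
  tame (fun y => expR (s * dotp x y - c)).
Proof.
split.
  apply: measurableT_comp => //; apply: measurable_funB => //.
  by apply: measurable_funM => //; exact: measurable_dotp.
exists (expR (- c)), (`|s| * norm1 x); split.
- exact: expR_ge0.
- by rewrite mulr_ge0// norm1_ge0.
move=> y; rewrite ger0_norm ?expR_ge0// -expRD ler_expR addrC lerD2l.
by rewrite (le_trans (ler_norm _))// normrM -mulrA ler_wpM2l// norm_dotp_le.
Qed.

Lemma tame_shift (s : R) (x : N.-tuple R) f :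
  tame f -> tame (fun z => f (shift_tuple s x z)).
Proof.
move=> [mf [C [k [C0 k0 fC]]]]; split.
  by apply: (measurableT_comp mf); exact: measurable_shift_tuple.
exists (C * expR (k * (`|s| * norm1 x))), k; split => //.
  by rewrite mulr_ge0// expR_ge0.
move=> y; rewrite (le_trans (fC _))// -mulrA ler_wpM2l// -expRD ler_expR -mulrDr.
rewrite ler_wpM2l// /norm1 mulr_sumr -big_split/= ler_sum// => i _.
by rewrite tnth_mktuple (le_trans (ler_normD _ _))// normrM.
Qed.

Definition gexp f : R := \int[gaussian_law N]_y f y.

Lemma gexp_EFin f : tame f ->
  (\int[gaussian_law N]_y (f y)%:E = (gexp f)%:E)%E.
Proof. by move=> tf; rewrite fineK//; apply: integrable_fin_num => //; exact: tame_integrable. Qed.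

Lemma gexpD f g : tame f -> tame g -> gexp (fun y => f y + g y) = gexp f + gexp g.
Proof. by move=> tf tg; rewrite /gexp RintegralD//; exact: tame_integrable. Qed.

Lemma gexpB f g : tame f -> tame g -> gexp (fun y => f y - g y) = gexp f - gexp g.
Proof. by move=> tf tg; rewrite /gexp RintegralB//; exact: tame_integrable. Qed.

Lemma gexpZ (c : R) f : tame f -> gexp (fun y => c * f y) = c * gexp f.
Proof. by move=> tf; rewrite /gexp RintegralZl//; exact: tame_integrable. Qed.

Lemma gexp_cst (c : R) : gexp (cst c) = c.
Proof.
rewrite /gexp /= Rintegral_cst//.
rewrite -[RHS]mulr1; congr (_ * _).
exact: (congr1 fine (@probability_setT _ _ _ (gaussian_law N))).
Qed.

Lemma gexp_sum (I : eqType) (r : seq I) (F : I -> N.-tuple R -> R) :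
  (forall i, i \in r -> tame (F i)) ->
  gexp (fun y => \sum_(i <- r) F i y) = \sum_(i <- r) gexp (F i).
Proof.
elim: r => [|i r IH] tF.
  rewrite big_nil; under [in LHS]eq_fun do rewrite big_nil.
  exact: gexp_cst.
rewrite big_cons; under [in LHS]eq_fun do rewrite big_cons.
have tr j : j \in r -> tame (F j) by move=> jr; apply: tF; rewrite inE jr orbT.
rewrite gexpD ?IH//; last exact: tame_sum.
by apply: tF; rewrite mem_head.
Qed.

Lemma le_gexp f g : tame f -> tame g -> (forall y, f y <= g y) -> gexp f <= gexp g.
Proof. by move=> tf tg fg; apply: le_Rintegral => //; exact: tame_integrable. Qed.

Lemma eq_gexp f g : f =1 g -> gexp f = gexp g.
Proof. by move=> fg; congr gexp; exact/funext. Qed.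

(** The formula for nonnegative functions, applied to the positive and negative
    parts. *)
Lemma gexp_shift (s : R) (x : N.-tuple R) f : measurable_fun setT f ->
  gexp (fun z => f (shift_tuple s x z)) =
  gexp (fun y => f y * expR (s * dotp x y - s ^+ 2 / 2 * dotp x x)).
Proof.
move=> mf; rewrite /gexp /Rintegral; congr fine.
rewrite integralE [RHS]integralE.
have mEf : measurable_fun setT (EFin \o f) by exact/measurable_EFinP.
congr (_ - _)%E.
- rewrite (funepos_comp (EFin \o f) (shift_tuple s x)) /=.
  rewrite ge0_cameron_martin//; last exact: measurable_funepos.
  by apply: eq_integral => y _; rewrite !funeposE EFinM maxe_pMl ?mul0e// lee_fin expR_ge0.
- rewrite (funeneg_comp (EFin \o f) (shift_tuple s x)) /=.
  rewrite ge0_cameron_martin//; last exact: measurable_funeneg.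
  by apply: eq_integral => y _; rewrite !funenegE EFinM -mulNe maxe_pMl ?mul0e// lee_fin expR_ge0.
Qed.

End tame.

(** * Convexity inequalities *)

(** The exponential lies above its tangent line at the mean of the a i. *)
Lemma sum_expR_ge (R : realType) (I : eqType) (r : seq I) (p a : I -> R) :
  (forall i, i \in r -> 0 <= p i) -> \sum_(i <- r) p i = 1 ->
  expR (\sum_(i <- r) p i * a i) <= \sum_(i <- r) p i * expR (a i).
Proof.
move=> p0 p1; set m := \sum_(i <- r) p i * a i.
have -> : expR m = \sum_(i <- r) p i * (expR m * (1 + (a i - m))).
  under eq_bigr => i _ do rewrite mulrCA mulrDr mulr1 mulrBr.
  by rewrite -mulr_sumr big_split/= sumrB -mulr_suml p1 -/m mul1r subrr addr0 mulr1.
rewrite big_seq [leRHS]big_seq ler_sum// => i ir; rewrite ler_wpM2l ?p0//.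
rewrite -[in leRHS](subrKC m (a i)) expRD ler_wpM2l ?expR_ge0//.
exact: expR_ge1Dx.
Qed.

(** The preceding inequality at a i = ln (b i). *)
Lemma jensen_ln (R : realType) (I : eqType) (r : seq I) (p b : I -> R) :
  (forall i, i \in r -> 0 <= p i) -> \sum_(i <- r) p i = 1 ->
  (forall i, i \in r -> 0 < b i) ->
  \sum_(i <- r) p i * ln (b i) <= ln (\sum_(i <- r) p i * b i).
Proof.
move=> p0 p1 b0.
have H := sum_expR_ge (fun i => ln (b i)) p0 p1.
have E : \sum_(i <- r) p i * expR (ln (b i)) = \sum_(i <- r) p i * b i.
  by rewrite big_seq [RHS]big_seq; apply: eq_bigr => i ir; rewrite lnK// posrE b0.
rewrite -ler_expR lnK -?E// posrE.
exact: lt_le_trans (expR_gt0 _) H.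
Qed.

(** The logarithm lies below its tangent line at u. Integrated against a
    reference measure for two probability densities u and v, this is the
    nonnegativity of relative entropy. *)
Lemma gibbs_ln (R : realType) (u v : R) : 0 < u -> 0 < v ->
  u * ln v + (u - v) <= u * ln u.
Proof.
move=> u0 v0; have L : ln (v / u) <= v / u - 1.
  by rewrite -[X in ln X](subrKC 1) le_ln1Dx// ltrBrDr addNr divr_gt0.
rewrite ln_div ?posrE// in L.
have uvu : u * (v / u) = v by rewrite mulrC divfK// gt_eqF.
by have := ler_wpM2l (ltW u0) L; rewrite !mulrBr uvu mulr1; lra.
Qed.

Lemma dotpC (R : realType) (N : nat) (x y : N.-tuple R) : dotp x y = dotp y x.
Proof. by apply: eq_bigr => i _; rewrite mulrC. Qed.

Lemma dotp_shift (R : realType) (N : nat) (s : R) (x v z : N.-tuple R) :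
  dotp x (shift_tuple s v z) = s * dotp x v + dotp x z.
Proof.
rewrite /dotp mulr_sumr -big_split/=; apply: eq_bigr => i _.
by rewrite tnth_mktuple mulrDr mulrCA.
Qed.

Lemma shift_tupleD (R : realType) (N : nat) (s t : R) (x z : N.-tuple R) :
  shift_tuple t x z = shift_tuple (t - s) x (shift_tuple s x z).
Proof. by apply: eq_from_tnth => i; rewrite !tnth_mktuple; ring. Qed.

Section gexp_extra.
Context {R : realType} {N : nat}.
Implicit Types f g : N.-tuple R -> R.

Lemma tame_dominated f g : measurable_fun setT f -> tame g ->
  (forall y, `|f y| <= g y) -> tame f.
Proof.
move=> mf [_ [C [k [C0 k0 gC]]]] fg; split => //; exists C, k; split => // y.
by rewrite (le_trans (fg y))// (le_trans (ler_norm _)).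
Qed.

Lemma tame_norm f : tame f -> tame (fun y => `|f y|).
Proof.
move=> [mf [C [k [C0 k0 fC]]]]; split; first exact: measurableT_comp.
by exists C, k; split => // y; rewrite normr_id.
Qed.

(** Read off the moment generating function: if m is the mean, then
    1 + h m <= exp (h^2 / 2) for every real h, so m vanishes. *)
Lemma gexp_dotp (x : N.-tuple R) : dotp x x = 1 -> gexp (dotp x) = 0.
Proof.
move=> x1; set m := gexp _.
have H h : 1 + h * m <= expR (h ^+ 2 / 2).
  have <- : gexp (fun y => expR (h * dotp x y - 0)) = expR (h ^+ 2 / 2).
    transitivity (gexp (fun y => expR (h ^+ 2 / 2) *
        (cst 1 y * expR (h * dotp x y - h ^+ 2 / 2 * dotp x x)))).
      by apply: eq_gexp => y; rewrite x1 mul1r -expRD; congr expR; ring.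
    rewrite gexpZ; last by apply: tameM; [exact: tame_cst|exact: tame_expR_dotp].
    by rewrite -(gexp_shift h x)// gexp_cst mulr1.
  rewrite -[1](@gexp_cst R N) -gexpZ; last exact: tame_dotp.
  rewrite -gexpD; [|exact: tame_cst|exact/tameZ/tame_dotp].
  apply: le_gexp.
  - by apply: tameD; [exact: tame_cst|exact/tameZ/tame_dotp].
  - exact: tame_expR_dotp.
  - by move=> y /=; rewrite subr0 expR_ge1Dx.
apply/eqP; rewrite -[_ == _]negbK; apply/negP => m0.
(* This h has absolute value at most 1/2 and satisfies h m >= h^2, so that
   1 + h m exceeds exp (h^2 / 2). *)
pose h := m / (1 + m ^+ 2).
have m20 : 0 < m ^+ 2 by rewrite exprn_even_gt0.
have hE : h * (1 + m ^+ 2) = m by rewrite divfK// gt_eqF// ltr_wpDr// ltW.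
have hm : 0 < h * m by rewrite /h mulrAC -expr2 divr_gt0// ltr_wpDr// ltW.
have hmE : h * m + h * m * m ^+ 2 = m ^+ 2
  by transitivity (m * (h * (1 + m ^+ 2))); [ring|rewrite hE expr2].
have hhE : h ^+ 2 + h ^+ 2 * m ^+ 2 = h * m.
  by transitivity (h * (h * (1 + m ^+ 2))); [ring|rewrite hE].
have hm0 : 0 < h * m * m ^+ 2 by rewrite mulr_gt0.
have hh0 : 0 <= h ^+ 2 * m ^+ 2 by rewrite mulr_ge0 ?sqr_ge0.
have u1 : h ^+ 2 / 2 < 1.
  suff : h * m < 1 by lra.
  have : h * m * (1 + m ^+ 2) < 1 * (1 + m ^+ 2) by lra.
  by rewrite ltr_pM2r// ltr_wpDr// ltW.
have e1 : expR (h ^+ 2 / 2) * (1 - h ^+ 2 / 2) <= 1.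
  rewrite -[leRHS](expRxMexpNx_1 (h ^+ 2 / 2)) ler_wpM2l ?expR_ge0//.
  exact: expR_ge1Dx.
have e2 : (1 + h * m) * (1 - h ^+ 2 / 2) <= 1.
  by rewrite (le_trans _ e1)// ler_wpM2r ?H//; lra.
have e3 : h ^+ 2 * (h * m) <= h ^+ 2 * m ^+ 2 by rewrite ler_wpM2l ?sqr_ge0//; lra.
by lra.
Qed.

End gexp_extra.

(** * Likelihood ratio and posterior of a finite prior *)

Section posterior.
Context {R : realType} {N : nat} (S : {fset N.-tuple R}).
Hypothesis S_neq0 : S != fset0.
Hypothesis S_sphere : forall x, x \in S -> dotp x x = 1.
Implicit Types (s t : R) (x y z : N.-tuple R).

Local Notation M := (#|` S|%:R : R).

(** The density of the law of s x + Z with respect to that of Z, for a unit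
    vector x. Throughout, s stands for the square root of the signal-to-noise
    ratio. *)
Definition tilt s x y : R := expR (s * dotp x y - s ^+ 2 / 2).

Definition lik s y : R := (\sum_(x <- S) tilt s x y) / M.

Definition post s y x : R := tilt s x y / (M * lik s y).

(** The inner product of x with the posterior mean. *)
Definition overlap s x y : R := \sum_(x' <- S) post s y x' * dotp x x'.

Definition rel_entropy s : R := gexp (fun y => lik s y * ln (lik s y)).

(** The mean squared norm of the posterior mean, expanded as the expected inner
    product of the posterior mean with a draw from the posterior. *)
Definition sqmean s : R :=
  gexp (fun y => lik s y * \sum_(x <- S) post s y x * overlap s x y).

Lemma card_gt0 : 0 < M.
Proof. by rewrite ltr0n cardfs_gt0. Qed.

Lemma card_ge1 : 1 <= M.
Proof. by rewrite ler1n cardfs_gt0. Qed.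

Lemma sum_cst (c : R) : \sum_(x <- S) c = c * M.
Proof. by rewrite big_const_seq count_predT iter_addr_0 mulr_natr. Qed.

Lemma tilt_gt0 s x y : 0 < tilt s x y. Proof. exact: expR_gt0. Qed.

Lemma ln_tilt s x y : ln (tilt s x y) = s * dotp x y - s ^+ 2 / 2.
Proof. by rewrite expRK. Qed.

Lemma tilt_le_lik s x y : x \in S -> tilt s x y <= M * lik s y.
Proof.
move=> xS; rewrite mulrC divfK ?gt_eqF ?card_gt0//.
by rewrite (big_fsetD1 x)//= lerDl sumr_ge0// => i _; exact/ltW/tilt_gt0.
Qed.

Lemma Mlik_gt0 s y : 0 < M * lik s y.
Proof.
case/fset0Pn : S_neq0 => x xS.
exact: lt_le_trans (tilt_gt0 s x y) (tilt_le_lik s y xS).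
Qed.

Lemma lik_gt0 s y : 0 < lik s y.
Proof. by rewrite -(pmulr_rgt0 _ card_gt0) Mlik_gt0. Qed.

Lemma post_gt0 s y x : 0 < post s y x.
Proof. by rewrite divr_gt0 ?tilt_gt0 ?Mlik_gt0. Qed.

Lemma sum_post s y : \sum_(x <- S) post s y x = 1.
Proof.
rewrite -mulr_suml [X in X / _](_ : _ = M * lik s y) ?divff ?gt_eqF ?Mlik_gt0//.
by rewrite /lik mulrC divfK// gt_eqF ?card_gt0.
Qed.

Lemma sum_post_cst s y (c : R) : \sum_(x <- S) post s y x * c = c.
Proof. by under eq_bigr do rewrite mulrC; rewrite -mulr_sumr sum_post mulr1. Qed.

Lemma post_le1 s y x : x \in S -> post s y x <= 1.
Proof. by move=> xS; rewrite ler_pdivrMr ?Mlik_gt0// mul1r tilt_le_lik. Qed.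

Lemma lik_post s y (f : N.-tuple R -> R) :
  lik s y * (\sum_(x <- S) post s y x * f x) = (\sum_(x <- S) tilt s x y * f x) / M.
Proof.
rewrite mulr_sumr mulr_suml; apply: eq_bigr => x _; rewrite /post.
by field; rewrite !gt_eqF ?lik_gt0 ?card_gt0.
Qed.

Lemma tame_tilt s x : tame (tilt s x).
Proof. exact: tame_expR_dotp. Qed.

Lemma tame_lik s : tame (lik s).
Proof.
rewrite /lik; under eq_fun do rewrite mulrC.
by apply: tameZ; apply: tame_sum => x _; exact: tame_tilt.
Qed.

Lemma measurable_ln_lik s : measurable_fun setT (fun y => ln (lik s y)).
Proof. by apply: measurableT_comp => //; case: (tame_lik s). Qed.

Lemma ln_lik_ge s x y : x \in S -> s * dotp x y - s ^+ 2 / 2 - ln M <= ln (lik s y).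
Proof.
move=> xS; rewrite -ln_tilt -ln_div ?posrE ?tilt_gt0 ?card_gt0//.
rewrite ler_ln ?posrE ?lik_gt0 ?(divr_gt0 (tilt_gt0 _ _ _) card_gt0)//.
by rewrite ler_pdivrMr ?card_gt0// mulrC tilt_le_lik.
Qed.

(** A log-likelihood grows at most linearly on the negative side, because lik
    is at least a fraction of a single tilt, and is below lik on the positive
    side. *)
Lemma tame_ln_lik s : tame (fun y => ln (lik s y)).
Proof.
case/fset0Pn : S_neq0 => x xS.
have tl : tame (fun y => s * dotp x y - (s ^+ 2 / 2 + ln M)).
  by apply: tameB; [exact/tameZ/tame_dotp|exact: tame_cst].
apply: (tame_dominated (measurable_ln_lik s) (tameD (tame_norm tl) (tame_lik s))).
move=> y; have := ln_lik_ge s y xS; have := ln_sublinear (lik_gt0 s y).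
have := lik_gt0 s y.
set a := ln _; set b := lik _ _; set c := _ * _ => b0 ab.
rewrite -[_ - _ - ln M]addrA -opprD; set d := c - _ => da.
rewrite ler_norml; apply/andP; split; last by rewrite (le_trans (ltW ab))// lerDr.
have := ler_norm (- d); rewrite normrN; lra.
Qed.

Lemma tame_post s x : x \in S -> tame (fun y => post s y x).
Proof.
move=> xS; apply: (@tame_bounded _ _ _ 1); last first.
  by move=> y; rewrite ger0_norm ?post_le1// ltW// post_gt0.
have -> : (fun y => post s y x) = (fun y => tilt s x y * expR (- (ln M + ln (lik s y)))).
  apply/funext => y; rewrite /post; congr (_ * _).
  by rewrite -lnM ?posrE ?card_gt0 ?lik_gt0// expRN lnK// posrE Mlik_gt0.
apply: measurable_funM; first by case: (tame_tilt s x).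
apply: measurableT_comp => //; apply: measurableT_comp => //.
by apply: measurable_funD => //; exact: measurable_ln_lik.
Qed.

Lemma tame_overlap s x : tame (overlap s x).
Proof.
apply: tame_sum => x' x'S; under eq_fun do rewrite mulrC.
by apply: tameZ; exact: tame_post.
Qed.

Lemma tame_lik_post s (F : N.-tuple R -> N.-tuple R -> R) :
  (forall x, x \in S -> tame (F x)) ->
  tame (fun y => lik s y * \sum_(x <- S) post s y x * F x y).
Proof.
move=> tF; apply: tameM; first exact: tame_lik.
by apply: tame_sum => x xS; apply: tameM; [exact: tame_post|exact: tF].
Qed.

(** The expectation of F (X, Y) computed in two ways: on the left Y is drawn
    first and X from its posterior, on the right X is drawn first and the noise
    added to it. The bridge is the Cameron-Martin formula. *)
Lemma gexp_bayes s (F : N.-tuple R -> N.-tuple R -> R) :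
  (forall x, x \in S -> tame (F x)) ->
  gexp (fun y => lik s y * \sum_(x <- S) post s y x * F x y) =
  (\sum_(x <- S) gexp (fun z => F x (shift_tuple s x z))) / M.
Proof.
move=> tF; under eq_gexp => y do rewrite (lik_post s y (F ^~ y)) mulrC.
rewrite gexpZ; last first.
  by apply: tame_sum => x xS; apply: tameM; [exact: tame_tilt|exact: tF].
rewrite gexp_sum; last first.
  by move=> x xS; apply: tameM; [exact: tame_tilt|exact: tF].
rewrite mulrC; congr (_ / _); rewrite big_seq [RHS]big_seq; apply: eq_bigr => x xS.
rewrite gexp_shift; last by case: (tF x xS).
by apply: eq_gexp => y; rewrite S_sphere// mulr1 mulrC.
Qed.

Lemma gexp_lik s : gexp (lik s) = 1.
Proof.
transitivity (gexp (fun y => lik s y * \sum_(x <- S) post s y x * cst 1 y)).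
  by apply: eq_gexp => y; rewrite -mulr_suml sum_post !mulr1.
rewrite (@gexp_bayes s (fun=> cst 1)); last by move=> *; exact: tame_cst.
rewrite (_ : \sum_(x <- S) _ = \sum_(x <- S) 1); last first.
  by apply: eq_bigr => x _; exact: gexp_cst.
by rewrite sum_cst mul1r divff// gt_eqF ?card_gt0.
Qed.

Lemma gexp_bayes1 s (f : N.-tuple R -> R) : tame f ->
  gexp (fun y => lik s y * f y) =
  (\sum_(x <- S) gexp (fun z => f (shift_tuple s x z))) / M.
Proof.
move=> tf; rewrite -(@gexp_bayes s (fun=> f))//.
by apply: eq_gexp => y; rewrite -mulr_suml sum_post mul1r.
Qed.

Lemma tilt_shift s t x x' y :
  tilt s x' (shift_tuple t x y) = tilt s x' y * expR (s * t * dotp x x').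
Proof.
by rewrite /tilt -expRD; congr expR; rewrite dotp_shift (dotpC x x'); ring.
Qed.

(** The function ln (lik s) is a log-sum-exp, hence convex, and its gradient is s
    times the posterior mean. *)
Lemma ln_lik_shift s t x y :
  s * t * overlap s x y <= ln (lik s (shift_tuple t x y)) - ln (lik s y).
Proof.
rewrite -ln_div ?posrE ?lik_gt0//.
have -> : lik s (shift_tuple t x y) / lik s y =
    \sum_(x' <- S) post s y x' * expR (s * t * dotp x x').
  rewrite /lik [X in X / M]( _ : _ = \sum_(x' <- S) tilt s x' y * expR (s * t * dotp x x')).
    rewrite -lik_post -/(lik s y) mulrAC divff ?mul1r// gt_eqF ?lik_gt0//.
  by apply: eq_bigr => x' _; exact: tilt_shift.
rewrite -ler_expR lnK; last first.
  rewrite posrE; apply: lt_le_trans (expR_gt0 _) _.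
  by apply: sum_expR_ge; [by move=> i _; rewrite ltW// post_gt0|exact: sum_post].
rewrite /overlap mulr_sumr; under eq_bigr do rewrite mulrCA.
by apply: sum_expR_ge; [by move=> i _; rewrite ltW// post_gt0|exact: sum_post].
Qed.

(** Gibbs' inequality replaces ln (lik t) by ln (lik s) in the first relative
    entropy; both terms are then expectations of the same function ln (lik s),
    at t X + Z and at s X + Z, and convexity compares them. The resulting
    first-order term is an expectation under the parameter s, hence a multiple
    of sqmean S s. *)
Theorem rel_entropy_subgradient s t :
  s * (t - s) * sqmean s <= rel_entropy t - rel_entropy s.
Proof.
have tll := tame_ln_lik s.
apply: (@le_trans _ _ (gexp (fun y => lik t y * ln (lik s y)) - rel_entropy s)).
  rewrite /rel_entropy !gexp_bayes1// -mulrBl -sumrB.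
  have -> : s * (t - s) * sqmean s =
      gexp (fun y => lik s y * \sum_(x <- S) post s y x * (s * (t - s) * overlap s x y)).
    rewrite /sqmean -gexpZ; last by apply: tame_lik_post => x _; exact: tame_overlap.
    apply: eq_gexp => y; rewrite [LHS]mulrCA; congr (_ * _).
    rewrite mulr_sumr; by apply: eq_bigr => x _; rewrite mulrCA.
  rewrite gexp_bayes; last by move=> x _; exact/tameZ/tame_overlap.
  rewrite ler_pM2r ?invr_gt0 ?card_gt0// big_seq [leRHS]big_seq ler_sum// => x xS.
  rewrite -gexpB; [|exact: (tame_shift _ _ tll)..].
  apply: le_gexp.
  - exact: (tame_shift s x (tameZ (s * (t - s)) (tame_overlap s x))).
  - by apply: tameB; exact: (tame_shift _ _ tll).
  - by move=> z; rewrite (shift_tupleD s t) ln_lik_shift.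
rewrite lerD2r /rel_entropy.
have -> : gexp (fun y => lik t y * ln (lik s y)) =
    gexp (fun y => lik t y * ln (lik s y) + (lik t y - lik s y)).
  rewrite gexpD ?gexpB ?gexp_lik ?subrr ?addr0//.
  - exact: tame_lik.
  - exact: tame_lik.
  - by apply: tameM => //; exact: tame_lik.
  - by apply: tameB; exact: tame_lik.
apply: le_gexp.
- by apply: tameD; [apply: tameM => //|apply: tameB]; exact: tame_lik.
- by apply: tameM; [exact: tame_lik|exact: tame_ln_lik].
- by move=> y; apply: gibbs_ln; exact: lik_gt0.
Qed.

End posterior.

(** * Bounds on the relative entropy and on the posterior mean *)

Section bounds.
Context {R : realType} {N : nat} (S : {fset N.-tuple R}).
Hypothesis S_neq0 : S != fset0.
Hypothesis S_sphere : forall x, x \in S -> dotp x x = 1.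
Implicit Types (s t : R) (x y z : N.-tuple R).

Local Notation M := (#|` S|%:R : R).
Local Notation M0 := (card_gt0 S_neq0).

(** The Gram matrix of S as a sum of rank-one matrices, one for each
    coordinate. *)
Lemma sum_dotpE (p r : N.-tuple R -> R) :
  \sum_(x <- S) p x * (\sum_(x' <- S) r x' * dotp x x') =
  \sum_(i < N) (\sum_(x <- S) p x * tnth x i) * (\sum_(x <- S) r x * tnth x i).
Proof.
transitivity (\sum_(x <- S) \sum_(i < N)
    (p x * tnth x i) * (\sum_(x' <- S) r x' * tnth x' i)).
  apply: eq_bigr => x _; rewrite mulr_sumr.
  under eq_bigr => x' _ do rewrite /dotp !mulr_sumr.
  rewrite exchange_big/=; apply: eq_bigr => i _; rewrite mulr_sumr.
  by apply: eq_bigr => x' _; ring.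
by rewrite exchange_big/=; apply: eq_bigr => i _; rewrite mulr_suml.
Qed.

Lemma dotp_le1 x x' : x \in S -> x' \in S -> dotp x x' <= 1.
Proof.
move=> /S_sphere x1 /S_sphere x'1.
have : 0 <= \sum_(i < N) (tnth x i - tnth x' i) ^+ 2.
  by apply: sumr_ge0 => i _; exact: sqr_ge0.
under eq_bigr => i _ do rewrite sqrrB expr2 (expr2 (tnth x' i)).
rewrite big_split/= sumrB -/(dotp x x) -/(dotp x' x') x1 x'1 sumrMnl -/(dotp x x').
by rewrite -mulr_natl; lra.
Qed.

Lemma sqmean_integrand_ge0 s y : 0 <= \sum_(x <- S) post S s y x * overlap S s x y.
Proof. by rewrite sum_dotpE sumr_ge0// => i _; rewrite -expr2 sqr_ge0. Qed.

Lemma overlap_le1 s x y : x \in S -> overlap S s x y <= 1.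
Proof.
move=> xS; rewrite -(sum_post S_neq0 s y) /overlap big_seq [leRHS]big_seq ler_sum//.
by move=> x' x'S; rewrite ler_piMr ?dotp_le1// ltW// post_gt0.
Qed.

Lemma tame_sqmean s : tame (fun y => lik S s y * \sum_(x <- S) post S s y x * overlap S s x y).
Proof. by apply: tame_lik_post => // x _; exact: tame_overlap. Qed.

Lemma sqmean_ge0 s : 0 <= sqmean S s.
Proof.
rewrite -(@gexp_cst R N 0); apply: le_gexp; [exact: tame_cst|exact: tame_sqmean|].
by move=> y; rewrite mulr_ge0 ?sqmean_integrand_ge0// ltW// lik_gt0.
Qed.

Lemma sqmean_le1 s : sqmean S s <= 1.
Proof.
rewrite -(gexp_lik S_neq0 S_sphere s); apply: le_gexp; [exact: tame_sqmean|exact: tame_lik|].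
move=> y; rewrite ler_piMr//; first by rewrite ltW// lik_gt0.
rewrite -(sum_post S_neq0 s y) big_seq [leRHS]big_seq ler_sum// => x xS.
by rewrite ler_piMr ?overlap_le1// ltW// post_gt0.
Qed.

Lemma lik0 y : lik S 0 y = 1.
Proof.
rewrite /lik; under eq_bigr do rewrite /tilt mul0r expr0n/= mul0r subr0 expR0.
by rewrite sum_cst mul1r divff// gt_eqF// M0.
Qed.

Lemma post0 y x : post S 0 y x = M^-1.
Proof.
by rewrite /post lik0 mulr1 /tilt mul0r expr0n/= mul0r subr0 expR0 mul1r.
Qed.

Lemma rel_entropy0 : rel_entropy S 0 = 0.
Proof.
rewrite /rel_entropy -[RHS](@gexp_cst R N).
by apply: eq_gexp => y; rewrite lik0 ln1 mulr0.
Qed.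

Lemma rel_entropy_ge0 s : 0 <= rel_entropy S s.
Proof.
by have := rel_entropy_subgradient S_neq0 S_sphere 0 s; rewrite !mul0r rel_entropy0 subr0.
Qed.

(** The posterior mean is an unbiased estimate of the prior mean, whose squared
    norm is sqmean S 0; integrate the nonnegative squared distance between the
    two. *)
Lemma sqmean_ge_sqmean0 s : sqmean S 0 <= sqmean S s.
Proof.
pose a x := \sum_(x' <- S) M^-1 * dotp x x'.
pose A := \sum_(x <- S) M^-1 * a x.
have A0 : sqmean S 0 = A.
  rewrite -[RHS](@gexp_cst R N); apply: eq_gexp => y; rewrite lik0 mul1r.
  apply: eq_bigr => x _; rewrite post0; congr (_ * _).
  by apply: eq_bigr => x' _; rewrite post0.
have tB : tame (fun y => lik S s y * \sum_(x <- S) post S s y x * a x).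
  by apply: (@tame_lik_post _ _ S S_neq0 s (fun x => cst (a x))) => x _; exact: tame_cst.
have EB : gexp (fun y => lik S s y * \sum_(x <- S) post S s y x * a x) = A.
  rewrite (@gexp_bayes _ _ S S_neq0 S_sphere s (fun x => cst (a x))); last first.
    by move=> x _; exact: tame_cst.
  rewrite /A -mulr_sumr mulrC; congr (_ * _).
  by apply: eq_bigr => x _; exact: gexp_cst.
have tA : tame (fun y => A * lik S s y) by apply: tameZ; exact: tame_lik.
rewrite A0; apply: (@le_trans _ _ (gexp (fun y =>
   2 * (lik S s y * \sum_(x <- S) post S s y x * a x) - A * lik S s y))).
  rewrite gexpB//; last exact: tameZ.
  by rewrite !gexpZ// ?gexp_lik// ?EB; [lra|exact: tame_lik].
apply: le_gexp; [by apply: tameB => //; exact: tameZ|exact: tame_sqmean|].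
move=> y; rewrite mulrCA (mulrC A) -mulrBr ler_wpM2l//; first by rewrite ltW// lik_gt0.
rewrite /A !sum_dotpE mulr_sumr -sumrB ler_sum// => i _.
set u := \sum_(_ <- _) _; set v := \sum_(_ <- _) _.
by have := sqr_ge0 (u - v); rewrite sqrrB; lra.
Qed.

(** Mutual information is at most ln M: given the signal x, the likelihood ratio
    is at least tilt s x / M, whose logarithm has mean s^2 / 2 - ln M. *)
Lemma rel_entropy_ge s : s ^+ 2 / 2 - ln M <= rel_entropy S s.
Proof.
have tll := tame_ln_lik S_neq0 s.
rewrite /rel_entropy gexp_bayes1// ler_pdivlMr ?M0//.
rewrite -sum_cst big_seq [leRHS]big_seq ler_sum// => x xS.
have td := tame_dotp x.
have tl : tame (fun y => s * dotp x y - (s ^+ 2 / 2 + ln M)).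
  by apply: tameB; [exact/tameZ/tame_dotp|exact: tame_cst].
apply: (@le_trans _ _ (gexp (fun z =>
    s * dotp x (shift_tuple s x z) - (s ^+ 2 / 2 + ln M)))).
  have -> : gexp (fun z => s * dotp x (shift_tuple s x z) - (s ^+ 2 / 2 + ln M)) =
      gexp (fun z => s * dotp x z + cst (s ^+ 2 / 2 - ln M) z).
    by apply: eq_gexp => z; rewrite dotp_shift S_sphere//=; field.
  rewrite gexpD; [|exact: tameZ|exact: tame_cst].
  by rewrite gexpZ// gexp_dotp ?S_sphere// mulr0 add0r gexp_cst.
apply: le_gexp.
- exact: (tame_shift s x tl).
- exact: (tame_shift s x tll).
- by move=> z; rewrite opprD addrA ln_lik_ge.
Qed.

(** The subgradient inequality at t, with the posterior mean bounded by 1. *)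
Lemma rel_entropy_lipschitz s t : 0 <= s -> s <= t ->
  rel_entropy S t - rel_entropy S s <= t * (t - s).
Proof.
move=> s0 st; have := rel_entropy_subgradient S_neq0 S_sphere t s.
have := sqmean_le1 t => q1.
have : t * (t - s) * sqmean S t <= t * (t - s).
  by rewrite ler_piMr// mulr_ge0 ?subr_ge0// (le_trans s0).
move: (rel_entropy S _) (rel_entropy S _) (sqmean S _) => e1 e2 q.
by rewrite -(opprB t s) mulrN mulNr; lra.
Qed.

End bounds.

(** Halving the interval n times divides the bound on the total increment by
    2 ^ n. *)
Lemma nonincreasing_of_quadratic_increment (R : realType) (H : R -> R) :
  (forall s t, 0 <= s -> s <= t -> H t - H s <= (t - s) ^+ 2 / 2) ->
  forall s t, 0 <= s -> s <= t -> H t <= H s.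
Proof.
move=> HH.
have Hn n : forall s t, 0 <= s -> s <= t -> H t - H s <= (t - s) ^+ 2 / 2 / 2 ^+ n.
  elim: n => [|n IH] s t s0 st; first by rewrite expr0 divr1 HH.
  have m1 : s <= (s + t) / 2 by lra.
  have m2 : (s + t) / 2 <= t by lra.
  have := IH _ _ s0 m1; have := IH _ _ (le_trans s0 m1) m2.
  have -> : t - (s + t) / 2 = (t - s) / 2 by field.
  have -> : (s + t) / 2 - s = (t - s) / 2 by field.
  set c := 2 ^+ n; rewrite (exprS 2 n) -/c => h1 h2.
  have c0 : 0 < c by rewrite exprn_gt0.
  have -> : (t - s) ^+ 2 / 2 / (2 * c) = 2 * (((t - s) / 2) ^+ 2 / 2 / c).
    by field; rewrite gt_eqF.
  by lra.
move=> s t s0 st; rewrite -subr_le0; apply/ler_addgt0Pr => e e0; rewrite add0r.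
set c := (t - s) ^+ 2 / 2.
have c0 : 0 <= c by rewrite divr_ge0 ?sqr_ge0.
have [n cn] : exists n, c / e < 2 ^+ n.
  exists (Num.truncn (c / e)).+1.
  apply: (lt_le_trans (truncnS_gt _)).
  by rewrite -natrX ler_nat ltnW// ltn_expl.
apply: (le_trans (Hn n _ _ s0 st)); rewrite -/c.
by rewrite ler_pdivrMr ?exprn_gt0// mulrC -ler_pdivrMr// ltW.
Qed.

(** Subtracting s^2 / 2 from F leaves increments that are quadratic in t - s. *)
Lemma increment_le_half_sqr (R : realType) (F : R -> R) :
  (forall s t, 0 <= s -> s <= t -> F t - F s <= t * (t - s)) ->
  forall s t, 0 <= s -> s <= t -> F t - F s <= (t ^+ 2 - s ^+ 2) / 2.
Proof.
move=> HF s t s0 st.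
suff : F t - t ^+ 2 / 2 <= F s - s ^+ 2 / 2 by lra.
apply: (nonincreasing_of_quadratic_increment (H := fun s => F s - s ^+ 2 / 2)) => //.
by move=> a b a0 ab; have := HF _ _ a0 ab; rewrite sqrrB; lra.
Qed.

(** Half the signal-to-noise ratio minus the relative entropy is the mutual
    information between signal and observation, which grows with the ratio. *)
Lemma rel_entropy_increment (R : realType) (N : nat) (S : {fset N.-tuple R})
    (S_neq0 : S != fset0) (S_sphere : forall x, x \in S -> dotp x x = 1) (s t : R) :
  0 <= s -> s <= t -> rel_entropy S t - rel_entropy S s <= (t ^+ 2 - s ^+ 2) / 2.
Proof. by apply: increment_le_half_sqr => a b; exact: rel_entropy_lipschitz. Qed.

(** * Concentration of the posterior against the overlap distribution *)

Section fano.
Context {R : realType} {N : nat} (S : {fset N.-tuple R}).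
Hypothesis S_neq0 : S != fset0.
Hypothesis S_sphere : forall x, x \in S -> dotp x x = 1.
Implicit Types (s t : R) (x y z : N.-tuple R).

Local Notation M := (#|` S|%:R : R).
Local Notation M0 := (card_gt0 S_neq0).

Definition ball_card t x : R := \sum_(x' <- S) (t <= dotp x x')%R%:R.

Lemma ball_card_ge1 t x : t <= 1 -> x \in S -> 1 <= ball_card t x.
Proof.
move=> t1 xS; rewrite /ball_card (big_fsetD1 x)//= S_sphere// t1 lerDl.
by apply: sumr_ge0 => x' _; exact: ler0n.
Qed.

(** Gibbs' inequality for the posterior against a subprobability vector r. *)
Lemma post_ln_ge s y (r : N.-tuple R -> R) : (forall x, x \in S -> 0 < r x) ->
  \sum_(x <- S) r x <= 1 ->
  \sum_(x <- S) post S s y x * ln (r x) <= \sum_(x <- S) post S s y x * ln (post S s y x).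
Proof.
move=> r0 r1.
have p0 x := post_gt0 S_neq0 s y x.
have b0 x : x \in S -> 0 < r x / post S s y x by move=> xS; rewrite divr_gt0// r0.
have := jensen_ln (fun x _ => ltW (p0 x)) (sum_post S_neq0 s y) b0.
have -> : \sum_(x <- S) post S s y x * (r x / post S s y x) = \sum_(x <- S) r x.
  by apply: eq_bigr => x _; rewrite mulrC divfK// gt_eqF.
have -> : \sum_(x <- S) post S s y x * ln (r x / post S s y x) =
    \sum_(x <- S) post S s y x * ln (r x) - \sum_(x <- S) post S s y x * ln (post S s y x).
  rewrite -sumrB big_seq [RHS]big_seq; apply: eq_bigr => x xS.
  by rewrite ln_div ?posrE ?r0// mulrBr.
by have := ln_le0 r1; lra.
Qed.

Lemma ln_post s y x : ln (post S s y x) = s * dotp x y - s ^+ 2 / 2 - ln M - ln (lik S s y).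
Proof.
rewrite /post ln_div ?posrE ?tilt_gt0 ?Mlik_gt0// ln_tilt.
by rewrite lnM ?posrE ?M0 ?lik_gt0// opprD addrA.
Qed.

(** Compare the posterior with a prediction of the signal from a nearby
    atom x: half of the mass is uniform on the ball of x and half is uniform on
    S. The logarithmic loss of this prediction is at most
    ln 2 + ln (ball_card t x) for signals in the ball, and ln 2 + ln M
    otherwise, an event controlled by Markov's inequality for 1 - dotp x x'. *)
Lemma ln_lik_le s y t x : t < 1 -> x \in S ->
  ln (lik S s y) <= \sum_(x' <- S) post S s y x' * (s * dotp x' y)
    - s ^+ 2 / 2 - ln M + ln 2 + ln (ball_card t x)
    + ln M / (1 - t) * (1 - overlap S s x y).
Proof.
move=> t1 xS; have c1 := ball_card_ge1 (ltW t1) xS.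
set c := ball_card t x in c1 *.
have c0 : 0 < c by exact: lt_le_trans c1.
have M0' := M0.
have lnM0 : 0 <= ln M by rewrite ln_ge0// card_ge1.
have p0 x' := post_gt0 S_neq0 s y x'.
have pc := sum_post_cst S_neq0 s y.
pose r x' := (t <= dotp x x')%R%:R / (2 * c) + (2 * M)^-1.
have r0 x' : x' \in S -> 0 < r x'.
  by move=> _; rewrite ltr_wpDl ?invr_gt0 ?mulr_gt0// divr_ge0 ?ler0n// mulr_ge0// ltW.
have r1 : \sum_(x' <- S) r x' <= 1.
  rewrite big_split/= -mulr_suml -/(ball_card t x) -/c sum_cst.
  have -> : c / (2 * c) + (2 * M)^-1 * M = 1 by field; rewrite !gt_eqF.
  by [].
have := post_ln_ge s y r0 r1.
under [X in _ <= X]eq_bigr do rewrite ln_post 3!mulrBr.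
rewrite !sumrB !pc => H.
have K x' : x' \in S -> - ln (r x') <= ln 2 + ln c + ln M / (1 - t) * (1 - dotp x x').
  move=> x'S; have d1 := dotp_le1 S_sphere xS x'S.
  have [tx|tx] := leP t (dotp x x').
    rewrite (@le_trans _ _ (ln 2 + ln c))//; last first.
      by rewrite lerDl mulr_ge0 ?subr_ge0// divr_ge0// subr_ge0 ltW.
    rewrite -lnM ?posrE// -lnV ?posrE ?r0//.
    rewrite ler_ln ?posrE ?invr_gt0 ?r0 ?mulr_gt0//.
    rewrite -[leRHS]invrK lef_pV2 ?posrE ?invr_gt0 ?r0 ?mulr_gt0//.
    by rewrite /r tx mul1r lerDl invr_ge0 mulr_ge0// ltW.
  rewrite /r (lt_geF tx) mul0r add0r lnV ?posrE ?mulr_gt0// opprK lnM ?posrE//.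
  have : ln M <= ln M / (1 - t) * (1 - dotp x x').
    rewrite mulrAC -mulrA ler_peMr// ler_pdivlMr ?subr_gt0// mul1r; lra.
  by have := ln_ge0 c1; lra.
have : - \sum_(x' <- S) post S s y x' * ln (r x') <=
    ln 2 + ln c + ln M / (1 - t) * (1 - overlap S s x y).
  have -> : ln 2 + ln c + ln M / (1 - t) * (1 - overlap S s x y) =
      \sum_(x' <- S) post S s y x' * (ln 2 + ln c + ln M / (1 - t) * (1 - dotp x x')).
    under eq_bigr do rewrite mulrDr (mulrCA _ (ln M / (1 - t))) mulrBr mulr1.
    by rewrite big_split/= -mulr_sumr sumrB pc sum_post.
  rewrite -sumrN big_seq [leRHS]big_seq ler_sum// => x' x'S.
  by rewrite -mulrN ler_wpM2l ?K// ltW.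
by move: H; lra.
Qed.

Lemma sum_ln_ball_card t : t < 1 ->
  (\sum_(x <- S) ln (ball_card t x)) / M <= ln ((\sum_(x <- S) ball_card t x) / M).
Proof.
move=> t1; rewrite mulrC [in X in _ <= ln X]mulrC !mulr_sumr.
apply: (@jensen_ln _ _ S (fun=> M^-1)).
- by move=> x _; rewrite invr_ge0 ltW// M0.
- by rewrite sum_cst mulVf// gt_eqF// M0.
- by move=> x xS; rewrite (lt_le_trans ltr01)// ball_card_ge1// ltW.
Qed.

(** The left side is the conditional entropy of the signal given the
    observation. Average the previous bound over a draw x from the posterior:
    the marginal law of x is the prior, so the ball sizes average uniformly and
    Jensen's inequality moves the logarithm outside. *)
Theorem rel_entropy_fano s t : t < 1 ->
  ln M - s ^+ 2 / 2 + rel_entropy S s <=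
  ln 2 + ln ((\sum_(x <- S) ball_card t x) / M) + ln M / (1 - t) * (1 - sqmean S s).
Proof.
move=> t1; set K := ln M / (1 - t).
pose d x := - (s ^+ 2 / 2) - ln M + ln 2 + ln (ball_card t x) + K.
pose F x y := s * dotp x y + (d x - K * overlap S s x y).
have tO x : tame (fun y => d x - K * overlap S s x y).
  by apply: (tameB (tame_cst (d x))); exact/tameZ/tame_overlap.
have tF x : tame (F x) by apply: tameD => //; exact/tameZ/tame_dotp.
have H : rel_entropy S s <= gexp (fun y => lik S s y * \sum_(x <- S) post S s y x * F x y).
  apply: le_gexp.
  - by apply: tameM; [exact: tame_lik|exact: tame_ln_lik].
  - by apply: tame_lik_post => // x _; exact: tF.
  - move=> y; rewrite ler_wpM2l//; first by rewrite ltW// lik_gt0.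
    have pc := sum_post_cst S_neq0 s y.
    set a := \sum_(x' <- S) post S s y x' * (s * dotp x' y).
    have -> : \sum_(x <- S) post S s y x * F x y =
        \sum_(x <- S) post S s y x * (a + (d x - K * overlap S s x y)).
      under eq_bigr do rewrite mulrDr; under [RHS]eq_bigr do rewrite mulrDr.
      by rewrite !big_split/= pc.
    rewrite -[leLHS]pc big_seq [leRHS]big_seq ler_sum// => x xS.
    rewrite ler_wpM2l//; first by rewrite ltW// post_gt0.
    by have := ln_lik_le s y t1 xS; rewrite -/a -/K /d mulrBr mulr1; lra.
have E x : x \in S -> gexp (fun z => F x (shift_tuple s x z)) =
    s ^+ 2 + d x - K * gexp (fun z => overlap S s x (shift_tuple s x z)).
  move=> xS.
  have tov := tame_shift s x (tame_overlap S_neq0 s x).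
  have -> : gexp (fun z => F x (shift_tuple s x z)) =
      gexp (fun z => s * dotp x z + (cst (s ^+ 2 + d x) z -
         K * overlap S s x (shift_tuple s x z))).
    by apply: eq_gexp => z; rewrite /F dotp_shift S_sphere//=; ring.
  have tk := tameZ K tov; have td := tameZ s (tame_dotp x).
  have tc : tame (cst (s ^+ 2 + d x) : N.-tuple R -> R) by exact: tame_cst.
  rewrite gexpD//; last exact: tameB.
  rewrite gexpB// !gexpZ//; last exact: tame_dotp.
  by rewrite gexp_dotp ?S_sphere// mulr0 add0r gexp_cst.
move: H; rewrite gexp_bayes//.
have -> : (\sum_(x <- S) gexp (fun z => F x (shift_tuple s x z))) / M =
   s ^+ 2 / 2 - ln M + ln 2 + K * (1 - sqmean S s) + (\sum_(x <- S) ln (ball_card t x)) / M.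
  rewrite /sqmean gexp_bayes//; last by move=> x _; exact: tame_overlap.
  rewrite big_seq (eq_bigr _ E) -big_seq sumrB -mulr_sumr.
  under eq_bigr do rewrite /d.
  rewrite (_ : \sum_(x <- S) _ = \sum_(x <- S)
    ((s ^+ 2 / 2 - ln M + ln 2 + K) + ln (ball_card t x))); last first.
    by apply: eq_bigr => x _; field.
  by rewrite big_split/= sum_cst; field; rewrite gt_eqF// M0.
by have := sum_ln_ball_card t1; lra.
Qed.

End fano.

(** * The joint law of signal and observation *)

Section signal_noise.
Context {R : realType} {N : nat} (S : {fset N.-tuple R}).
Hypothesis S_neq0 : S != fset0.

Local Notation M := (#|` S|%:R : R).
Local Notation M0 := (card_gt0 S_neq0).
Local Notation T := (N.-tuple R * N.-tuple R)%type.

Lemma ge0_integral_uniform_law (f : N.-tuple R -> \bar R) :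
  measurable_fun setT f -> (forall x, 0 <= f x)%E ->
  (\int[uniform_law S]_x f x = M^-1%:E * \sum_(x <- S) f x)%E.
Proof.
move=> mf f0.
have Mn : 0 <= M^-1 by rewrite invr_ge0 ltW// M0.
pose m := @msum _ _ R (fun k => \d_(nth (nseq_tuple N 0 : N.-tuple R) S k)) #|` S|.
pose k := NngNum Mn.
rewrite (@eq_measure_integral _ _ _ _ (mscale k m)); last first.
  move=> A mA _; transitivity ((\sum_(x <- S) \1_A x) / M)%:E.
    exact: uniform_lawE.
  rewrite mulrC EFinM; transitivity (M^-1%:E * m A)%E => //.
  rewrite /m /msum; congr (_ * _)%E.
  by rewrite -sumEFin (big_nth (nseq_tuple N 0)) big_mkord.
rewrite ge0_integral_mscale// /= ge0_integral_measure_sum//.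
congr (_ * _)%E; rewrite (big_nth (nseq_tuple N 0)) big_mkord.
by apply: eq_bigr => i _; rewrite integral_dirac// diracT mul1e.
Qed.

Lemma ge0_integral_signal_noise_law (f : T -> \bar R) :
  measurable_fun setT f -> (forall w, 0 <= f w)%E ->
  (\int[signal_noise_law S]_w f w =
   M^-1%:E * \sum_(x <- S) \int[gaussian_law N]_z f (x, z))%E.
Proof.
move=> mf f0; rewrite fubini_tonelli1// ge0_integral_uniform_law//.
  exact: measurable_fun_fubini_tonelli_F.
by move=> x; apply: integral_ge0.
Qed.

Lemma ge0_integral_signal_noise_tame (f : T -> R) :
  measurable_fun setT f -> (forall w, 0 <= f w) ->
  (forall x, x \in S -> tame (fun z => f (x, z))) ->
  (\int[signal_noise_law S]_w (f w)%:E =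
   ((\sum_(x <- S) gexp (fun z => f (x, z))) / M)%:E)%E.
Proof.
move=> mf f0 tf; rewrite ge0_integral_signal_noise_law//; last exact/measurable_EFinP.
rewrite mulrC EFinM -sumEFin; congr (_ * _)%E.
by rewrite big_seq [RHS]big_seq; apply: eq_bigr => x xS; rewrite gexp_EFin//; exact: tf.
Qed.

Lemma integrable_signal_noise_tame (f : T -> R) :
  measurable_fun setT f -> (forall x, x \in S -> tame (fun z => f (x, z))) ->
  (signal_noise_law S).-integrable setT (EFin \o f).
Proof.
move=> mf tf; apply/integrableP; split; first exact/measurable_EFinP.
rewrite (@ge0_integral_signal_noise_tame (fun w => `|f w|)) ?ltry//.
- exact: measurableT_comp.
- by move=> x xS; exact: tame_norm (tf x xS).
Qed.

(** Write f as the difference of the nonnegative functions f + |f| and |f|. *)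
Lemma integral_signal_noise_tame (f : T -> R) :
  measurable_fun setT f -> (forall x, x \in S -> tame (fun z => f (x, z))) ->
  (\int[signal_noise_law S]_w (f w)%:E =
   ((\sum_(x <- S) gexp (fun z => f (x, z))) / M)%:E)%E.
Proof.
move=> mf tf.
have mn : measurable_fun setT (fun w => `|f w|) by exact: measurableT_comp.
have tn x : x \in S -> tame (fun z => `|f (x, z)|).
  by move=> xS; exact: tame_norm (tf x xS).
have mg : measurable_fun setT (fun w => f w + `|f w|) by exact: measurable_funD.
have tg x : x \in S -> tame (fun z => f (x, z) + `|f (x, z)|).
  by move=> xS; apply: tameD; [exact: tf|exact: tn].
transitivity (\int[signal_noise_law S]_w ((f w + `|f w|)%:E - (`|f w|)%:E))%E.
  by apply: eq_integral => w _; rewrite -EFinB addrK.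
rewrite integralB_EFin//; [|exact: integrable_signal_noise_tame..].
rewrite !ge0_integral_signal_noise_tame//; last first.
  by move=> w; have := ler_norm (- f w); rewrite normrN; lra.
rewrite -EFinB -mulrBl -sumrB; congr (_ / _)%:E.
rewrite big_seq [RHS]big_seq; apply: eq_bigr => x xS.
by rewrite gexpD ?addrK//; [exact: tf|exact: tn].
Qed.

End signal_noise.

Section observed.
Context {R : realType} {N : nat} (S : {fset N.-tuple R}).
Hypothesis S_neq0 : S != fset0.
Hypothesis S_sphere : forall x, x \in S -> dotp x x = 1.
Local Notation M := (#|` S|%:R : R).
Local Notation T := (N.-tuple R * N.-tuple R)%type.
Variable lambda : R.
Local Notation s := (Num.sqrt lambda).

Lemma measurable_observed (F : N.-tuple R -> N.-tuple R -> R) :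
  measurable_fun setT (fun w : T => F w.1 w.2) ->
  measurable_fun setT (fun w : T => F w.1 (observation lambda w)).
Proof.
move=> mF.
rewrite (_ : (fun _ => _) =
  (fun w : T => F w.1 w.2) \o (fun w : T => (w.1, observation lambda w)))//.
apply: measurableT_comp => //; apply: measurable_fun_pair.
  exact: measurable_fst.
exact: measurable_observation.
Qed.

(** Bayes' formula for the joint law of signal and observation. *)
Lemma integral_observed (F : N.-tuple R -> N.-tuple R -> R) :
  measurable_fun setT (fun w : T => F w.1 w.2) -> (forall x, x \in S -> tame (F x)) ->
  (\int[signal_noise_law S]_w (F w.1 (observation lambda w))%:E =
   (gexp (fun y => lik S s y * \sum_(x <- S) post S s y x * F x y))%:E)%E.
Proof.
move=> mF tF; rewrite (@integral_signal_noise_tame _ _ _ S_neq0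
  (fun w => F w.1 (observation lambda w))).
- by rewrite gexp_bayes.
- exact: measurable_observed.
- by move=> x xS; exact: (tame_shift s x (tF x xS)).
Qed.

Lemma integrable_observed (F : N.-tuple R -> N.-tuple R -> R) :
  measurable_fun setT (fun w : T => F w.1 w.2) -> (forall x, x \in S -> tame (F x)) ->
  (signal_noise_law S).-integrable setT (fun w => (F w.1 (observation lambda w))%:E).
Proof.
move=> mF tF; apply: (@integrable_signal_noise_tame _ _ _ S_neq0
  (fun w => F w.1 (observation lambda w))).
- exact: measurable_observed.
- by move=> x xS; exact: (tame_shift s x (tF x xS)).
Qed.

Lemma tame_indic (B : set (N.-tuple R)) : measurable B -> tame (\1_B : _ -> R).
Proof.
move=> mB; apply: (@tame_bounded _ _ _ 1); first exact: measurable_indic.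
by move=> y; rewrite indicE; case: (_ \in _); rewrite ?normr1 ?normr0.
Qed.

Lemma observation_law_density (A : set (N.-tuple R)) : measurable A ->
  (observation_law S lambda A = \int[gaussian_law N]_(y in A) (lik S s y)%:E)%E.
Proof.
move=> mA.
transitivity (\int[signal_noise_law S]_w (\1_A (observation lambda w))%:E)%E.
  rewrite (@integral_indic _ _ _ (signal_noise_law S) setT measurableT
    (observation lambda @^-1` A)) ?setIT//.
  rewrite -[X in measurable X]setTI; exact: measurable_observation.
rewrite (@integral_observed (fun=> \1_A)); last 2 first.
- by apply: measurableT_comp => //; exact: measurable_indic.
- by move=> x _; exact: tame_indic.
rewrite integral_mkcond epatch_indic -gexp_EFin; last first.
  by apply: tame_lik_post => // x _; exact: tame_indic.
by apply: eq_integral => y _; rewrite (sum_post_cst S_neq0) EFinM.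
Qed.

End observed.

(** * Divergence and mean square error in terms of the likelihood ratio *)

(** On finite values the extended logarithm is a case distinction between -oo and
    the real logarithm. *)
Lemma measurable_lne_fin d (T : measurableType d) (R : realType) (f : T -> \bar R) :
  measurable_fun setT f -> (forall x, f x \is a fin_num) ->
  measurable_fun setT (fun x => lne (f x)).
Proof.
move=> mf ff.
have mff : measurable_fun setT (fun x => fine (f x)) by exact: measurableT_comp.
rewrite (_ : (fun _ => _) =
    fun x => if (fine (f x) <= 0) then -oo%E else (ln (fine (f x)))%:E); last first.
  by apply/funext => x; rewrite /lne -(fineK (ff x)).
apply: measurable_fun_ifT.
- exact: measurable_fun_ler.
- exact: measurable_cst.
- by apply/measurable_EFinP; exact: measurableT_comp.
Qed.

Section divergence.
Local Open Scope charge_scope.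
Context {R : realType} {N : nat} (S : {fset N.-tuple R}).
Hypothesis S_neq0 : S != fset0.
Hypothesis S_sphere : forall x, x \in S -> dotp x x = 1.

Lemma observation_law0 (A : set (N.-tuple R)) : measurable A ->
  observation_law S 0 A = gaussian_law N A.
Proof.
move=> mA; rewrite observation_law_density// sqrtr0.
under eq_integral do rewrite lik0//.
by rewrite (integral_cst (gaussian_law N))// mul1e.
Qed.

Lemma observation_law_dominates (lambda : R) :
  observation_law S lambda `<< observation_law S 0.
Proof.
apply/null_content_dominatesP => A mA A0.
have {}A0 : gaussian_law N A = 0%E by rewrite -observation_law0.
rewrite [LHS](observation_law_density S_neq0 S_sphere lambda mA).
apply: null_set_integral => //.
by apply/measurable_EFinP/measurable_funTS; case: (tame_lik S (Num.sqrt lambda)).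
Qed.

(** The Radon-Nikodym derivative in KL agrees with lik almost everywhere, where
    it is positive and finite. *)
Theorem KL_observation_law (lambda : R) :
  (KL (observation_law S lambda) (observation_law S 0) =
   (rel_entropy S (Num.sqrt lambda))%:E)%E.
Proof.
set s := Num.sqrt lambda; rewrite /KL.
have dom := observation_law_dominates lambda.
set f := 'd _ '/d _.
have fi : (observation_law S 0).-integrable setT f.
  exact: Radon_Nikodym_integrable.
have ff x : f x \is a fin_num by exact: Radon_Nikodym_fin_num.
have ml : measurable_fun setT (lik S s) by case: (tame_lik S s).
have mEl : measurable_fun setT (EFin \o lik S s) by exact/measurable_EFinP.
have fE : ae_eq (observation_law S 0) setT f (EFin \o lik S s).
  apply: integral_ae_eq => // A _ mA.
  rewrite -Radon_Nikodym_integral//=.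
  rewrite [LHS](observation_law_density S_neq0 S_sphere lambda mA).
  by apply: eq_measure_integral => B mB _; exact/esym/observation_law0.
have mf : measurable_fun setT f by exact: measurable_int fi.
have tll : tame (fun y => lik S s y * ln (lik S s y)).
  by apply: tameM; [exact: tame_lik|exact: tame_ln_lik].
transitivity (\int[observation_law S 0]_x (lik S s x * ln (lik S s x))%:E)%E.
  apply: ae_eq_integral => //.
  - by apply: emeasurable_funM => //; exact: measurable_lne_fin.
  - by apply/measurable_EFinP; case: tll.
  - apply: filterS fE => x fx xT; have l0 := lik_gt0 S_neq0 s x.
    rewrite /= fx//; transitivity ((lik S s x)%:E * lne (lik S s x)%:E)%E => //.
    by rewrite lne_EFin// EFinM.
rewrite (eq_measure_integral (gaussian_law N)); last first.
  by move=> A mA _; exact: observation_law0.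
by rewrite gexp_EFin.
Qed.

End divergence.

Section conditional_expectation.
Context {R : realType} d d' (T : measurableType d) (U : measurableType d')
  (P : probability T R) (Y : T -> U).
Hypothesis mY : measurable_fun setT Y.

Lemma g_sigma_algebra_preimage_measurable (A : set T) :
  g_sigma_algebra_preimage Y A -> measurable A.
Proof. by case=> B mB <-; exact: mY. Qed.

Lemma is_cond_exp_measurable (X g : T -> R) :
  is_cond_exp P Y X g -> measurable_fun setT g.
Proof.
move=> [mg _ _] _ B mB; have := mg measurableT B mB.
exact: g_sigma_algebra_preimage_measurable.
Qed.

(** The event h < g is determined by Y, so g - h integrates to 0 on it, although
    it is positive there. *)
Lemma is_cond_exp_ae_le (X g h : T -> R) :
  is_cond_exp P Y X g -> is_cond_exp P Y X h -> {ae P, forall w, g w <= h w}.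
Proof.
move=> cg ch.
have mg := is_cond_exp_measurable cg; have mh := is_cond_exp_measurable ch.
move: cg ch => [mgY ig gE] [mhY ih hE].
pose A := [set w | h w < g w].
have AY : g_sigma_algebra_preimage Y A.
  have := @measurable_fun_ltr _ (g_sigma_algebra_preimageType Y) R setT h g mhY mgY.
  move=> /(_ measurableT [set true] I); rewrite setTI.
  by congr g_sigma_algebra_preimage; apply/seteqP; split.
have mA := g_sigma_algebra_preimage_measurable AY.
have igA := integrableS measurableT mA (@subsetT _ A) ig.
have ihA := integrableS measurableT mA (@subsetT _ A) ih.
have H : ae_eq P A (fun w => (g w - h w)%:E) (cst 0%E).
  apply/ae_eq_integral_abs => //.
    by apply/measurable_EFinP/measurable_funTS; exact: measurable_funB.
  transitivity (\int[P]_(w in A) (g w - h w)%:E)%E.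
    apply: eq_integral => w /[!inE] wA /=.
    by rewrite ger0_norm// subr_ge0 ltW.
  rewrite integralB_EFin// gE// hE// subee//.
  rewrite -hE//; exact: integrable_fin_num.
apply: filterS H => w /= H; rewrite leNgt; apply/negP => wA.
have /eqP := H wA; rewrite eqe subr_eq0 => /eqP gh.
by move: wA; rewrite gh ltxx.
Qed.

Lemma is_cond_exp_ae_eq (X g h : T -> R) :
  is_cond_exp P Y X g -> is_cond_exp P Y X h -> {ae P, forall w, g w = h w}.
Proof.
move=> cg ch; have := is_cond_exp_ae_le cg ch; have := is_cond_exp_ae_le ch cg.
by apply: filterS2 => w hg gh; apply/eqP; rewrite eq_le hg gh.
Qed.

Lemma cond_expP (X g : T -> R) : is_cond_exp P Y X g ->
  is_cond_exp P Y X (cond_exp P Y X).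
Proof. by move=> cg; apply: (@xgetPex _ (cst 0) [set h | is_cond_exp P Y X h]); exists g. Qed.

End conditional_expectation.

Section bayes_risk.
Context {R : realType} {N : nat} (S : {fset N.-tuple R}).
Hypothesis S_neq0 : S != fset0.
Hypothesis S_sphere : forall x, x \in S -> dotp x x = 1.
Variable lambda : R.
Local Notation s := (Num.sqrt lambda).
Local Notation T := (N.-tuple R * N.-tuple R)%type.

Definition post_mean i y : R := \sum_(x <- S) post S s y x * tnth x i.

Lemma tame_post_mean i : tame (post_mean i).
Proof.
apply: tame_sum => x xS; under eq_fun do rewrite mulrC.
by apply: tameZ; exact: tame_post.
Qed.

(** On an event determined by the observation, X and the posterior mean have the
    same integral by Bayes' formula. *)
Lemma is_cond_exp_post_mean i :
  is_cond_exp (signal_noise_law S) (@observation R N lambda)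
    (fun w => tnth w.1 i) (fun w => post_mean i (observation lambda w)).
Proof.
have [mpm _] := tame_post_mean i.
have mo := @measurable_observation R N lambda.
split.
- move=> _ B mB; exists (post_mean i @^-1` B) => //.
  by rewrite -[X in measurable X]setTI; exact: mpm.
- apply: (@integrable_observed _ _ S S_neq0 lambda (fun=> post_mean i)).
    by apply: measurableT_comp => //; exact: measurable_snd.
  by move=> x _; exact: tame_post_mean.
move=> _ [B mB <-]; rewrite setTI.
have restr (h : T -> R) : (\int[signal_noise_law S]_(w in observation lambda @^-1` B)
      (h w)%:E = \int[signal_noise_law S]_w (h w * \1_B (observation lambda w))%:E)%E.
  by rewrite integral_mkcond epatch_indic; apply: eq_integral => w _; rewrite /= EFinM.
rewrite !restr.
have tB := tame_indic mB.
have mB2 : measurable_fun setT (fun w : T => \1_B w.2 : R).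
  by apply: measurableT_comp => //; exact: measurable_indic.
have mX : measurable_fun setT (fun w : T => tnth w.1 i).
  exact: (measurableT_comp (measurable_tnth i) measurable_fst).
rewrite (@integral_observed _ _ S S_neq0 S_sphere lambda
  (fun _ y => post_mean i y * \1_B y)); last 2 first.
- apply: measurable_funM => //.
  by apply: measurableT_comp => //; exact: measurable_snd.
- by move=> x _; apply: tameM => //; exact: tame_post_mean.
rewrite (@integral_observed _ _ S S_neq0 S_sphere lambda
  (fun x y => tnth x i * \1_B y)); last 2 first.
- exact: measurable_funM.
- by move=> x _; exact: tameZ.
congr (_%:E); apply: eq_gexp => y; congr (_ * _).
rewrite (sum_post_cst S_neq0) /post_mean mulr_suml.
by apply: eq_bigr => x _; rewrite mulrA.
Qed.

(** The posterior variance of a unit vector is 1 minus the squared norm of the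
    posterior mean. *)
Theorem gaussian_mmseE : gaussian_mmse S lambda = (1 - sqmean S s)%:E.
Proof.
rewrite /gaussian_mmse /mmse unlock.
have mo := @measurable_observation R N lambda.
pose F x y := \sum_(i < N) (tnth x i - post_mean i y) ^+ 2.
have tF x : tame (F x).
  rewrite /F -[index_enum _]/(index_enum 'I_N); apply: tame_sum => i _.
  have t1 : tame (fun y => tnth x i - post_mean i y).
    by apply: (tameB (tame_cst _)); exact: tame_post_mean.
  exact: tameM.
have mF : measurable_fun setT (fun w : T => F w.1 w.2).
  apply: measurable_sum => i; apply: measurable_funX; apply: measurable_funB.
    exact: (measurableT_comp (measurable_tnth i) measurable_fst).
  apply: measurableT_comp; first by case: (tame_post_mean i).
  exact: measurable_snd.
have c1 i := cond_expP (is_cond_exp_post_mean i).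
transitivity (\int[signal_noise_law S]_w (F w.1 (observation lambda w))%:E)%E.
  apply: ae_eq_integral => //.
  - apply/measurable_EFinP; apply: measurable_sum => i; apply: measurable_funX.
    apply: measurable_funB.
      exact: (measurableT_comp (measurable_tnth i) measurable_fst).
    exact: is_cond_exp_measurable (c1 i).
  - by apply/measurable_EFinP; exact: measurable_observed.
  - have H i : {ae signal_noise_law S, forall w,
        cond_exp (signal_noise_law S) (@observation R N lambda)
          (fun v => tnth v.1 i) w = post_mean i (observation lambda w)}.
      exact: is_cond_exp_ae_eq (c1 i) (is_cond_exp_post_mean i).
    have : {ae signal_noise_law S, forall w, forall i,
        cond_exp (signal_noise_law S) (@observation R N lambda)
          (fun v => tnth v.1 i) w = post_mean i (observation lambda w)}.
      exact: filter_forall.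
    apply: filterS => w Hw _; congr (_%:E).
    by apply: eq_bigr => i _; rewrite Hw.
rewrite integral_observed//; congr (_%:E).
have tq := tame_sqmean S_neq0 s.
have tl := tame_lik S s.
rewrite -(gexp_lik S_neq0 S_sphere s) /sqmean -gexpB//.
apply: eq_gexp => y; rewrite -[X in X - _]mulr1 -mulrBr; congr (_ * _).
have -> : \sum_(x <- S) post S s y x * overlap S s x y = \sum_(i < N) post_mean i y ^+ 2.
  by rewrite sum_dotpE; apply: eq_bigr => i _; rewrite expr2.
transitivity (\sum_(x <- S) post S s y x * (1 + \sum_(i < N) post_mean i y ^+ 2 -
    \sum_(i < N) 2 * (tnth x i * post_mean i y))).
  rewrite big_seq [RHS]big_seq; apply: eq_bigr => x xS; congr (_ * _).
  rewrite -[X in X + _ - _](S_sphere xS) /F /dotp -big_split/= -sumrB; apply: eq_bigr => i _.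
  by ring.
under eq_bigr do rewrite mulrBr.
rewrite sumrB (sum_post_cst S_neq0).
have -> : \sum_(x <- S) post S s y x * (\sum_(i < N) 2 * (tnth x i * post_mean i y)) =
    \sum_(i < N) 2 * post_mean i y ^+ 2.
  under eq_bigr do rewrite mulr_sumr.
  rewrite exchange_big/=; apply: eq_bigr => i _.
  transitivity (post_mean i y * (2 * post_mean i y)); last by ring.
  by rewrite {2}/post_mean mulr_suml; apply: eq_bigr => x _; ring.
by rewrite -mulr_sumr; lra.
Qed.

End bayes_risk.

(** * Inequalities at finite dimension *)

Section finite_size.
Context {R : realType} {N : nat} (S : {fset N.-tuple R}).
Hypothesis S_neq0 : S != fset0.
Hypothesis S_sphere : forall x, x \in S -> dotp x x = 1.
Local Notation M := (#|` S|%:R : R).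
Local Notation M0 := (card_gt0 S_neq0).
Implicit Types (s t b r u : R).

Definition pair_prob t : R := (\sum_(x <- S) ball_card S t x) / M ^+ 2.

Lemma pair_probE t :
  ((uniform_law S \x uniform_law S) [set xx | (t <= dotp xx.1 xx.2)%R])%E =
  (pair_prob t)%:E.
Proof.
set A := [set _ | _].
have mdot : measurable_fun setT (fun w : N.-tuple R * N.-tuple R => dotp w.1 w.2).
  apply: measurable_sum => i; apply: measurable_funM.
    exact: (measurableT_comp (measurable_tnth i) measurable_fst).
  exact: (measurableT_comp (measurable_tnth i) measurable_snd).
have mA : measurable A.
  rewrite -[A]setTI (_ : A = (fun w => dotp w.1 w.2) @^-1` `[t, +oo[%classic).
    exact: mdot.
  by apply/seteqP; split => w; rewrite /A/= in_itv/= andbT.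
have I0 w : (0 <= (EFin \o \1_A : _ -> \bar R) w)%E by rewrite lee_fin.
have mI : measurable_fun setT (EFin \o \1_A : _ -> \bar R).
  by apply/measurable_EFinP; exact: measurable_indic.
transitivity (\int[(uniform_law S \x uniform_law S)%E]_w (\1_A w)%:E)%E.
  by rewrite integral_indic// setIT.
rewrite (@fubini_tonelli1 _ _ _ _ _ (uniform_law S) (uniform_law S) (EFin \o \1_A))//.
rewrite ge0_integral_uniform_law//; last 2 first.
- exact: measurable_fun_fubini_tonelli_F.
- by move=> x; apply: integral_ge0 => y _; exact: I0.
have inner x : fubini_F (uniform_law S) (EFin \o \1_A) x = (M^-1 * ball_card S t x)%:E.
  rewrite /fubini_F ge0_integral_uniform_law//; last first.
    have : measurable_fun setT ((EFin \o \1_A : _ -> \bar R) \o pair x).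
      by apply: measurableT_comp => //; exact: measurable_pair1.
    exact.
  rewrite EFinM; congr (_ * _)%E; rewrite -sumEFin.
  by apply: eq_bigr => y _; rewrite /= indicE mem_setE.
under eq_bigr do rewrite inner.
rewrite sumEFin -EFinM -mulr_sumr; congr (_%:E).
by rewrite /pair_prob; field; rewrite gt_eqF// M0.
Qed.

Lemma pair_prob_gt0 t : t <= 1 -> 0 < pair_prob t.
Proof.
move=> t1; rewrite divr_gt0 ?exprn_gt0 ?M0//.
apply: (lt_le_trans M0); rewrite -[leLHS]mul1r -sum_cst big_seq [leRHS]big_seq.
by rewrite ler_sum// => x xS; exact: ball_card_ge1.
Qed.

(** The Fano inequality with the relative entropy dropped: the left side is
    ln M minus the logarithm of the average ball size. *)
Lemma ln_pair_prob_ge s t : t < 1 ->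
  - ln (pair_prob t) <= s ^+ 2 / 2 + ln 2 + ln M / (1 - t) * (1 - sqmean S s).
Proof.
move=> t1; have := rel_entropy_fano S_neq0 S_sphere s t1.
have -> : (\sum_(x <- S) ball_card S t x) / M = M * pair_prob t.
  by rewrite /pair_prob; field; rewrite gt_eqF// M0.
rewrite lnM ?posrE ?M0 ?(pair_prob_gt0 (ltW t1))//.
by have := rel_entropy_ge0 S_neq0 S_sphere s; lra.
Qed.

(** The subgradient inequality towards 0 controls G at b' u, and the growth of
    G from b' u to b u is at most half the increment of the square. *)
Lemma rel_entropy_le_sqmean b b' u : 0 <= u -> 0 <= b' -> b' <= b ->
  rel_entropy S (b * u) <=
  u ^+ 2 * (b' ^+ 2 * sqmean S (b' * u) + (b ^+ 2 - b' ^+ 2) / 2).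
Proof.
move=> u0 b'0 bb.
have := rel_entropy_subgradient S_neq0 S_sphere (b' * u) 0.
have := @rel_entropy_increment _ _ _ S_neq0 S_sphere (b' * u) (b * u).
rewrite mulr_ge0// ler_wpM2r// => /(_ isT isT).
rewrite rel_entropy0//.
by move: (rel_entropy S _) (rel_entropy S _) (sqmean S _) => e1 e2 q1; lra.
Qed.

Lemma rel_entropy_le s t : 0 <= s -> s <= t -> rel_entropy S s <= rel_entropy S t.
Proof.
move=> s0 st; have := rel_entropy_subgradient S_neq0 S_sphere s t.
have : 0 <= s * (t - s) * sqmean S s by rewrite !mulr_ge0 ?subr_ge0 ?sqmean_ge0.
by move: (rel_entropy S t) (rel_entropy S s) (sqmean S s) => e1 e2 q1; lra.
Qed.

(** The subgradient inequality at b u, towards u. *)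
Lemma sqmean_le_rel_entropy b u : 0 < b -> b < 1 -> 0 < u ->
  sqmean S (b * u) <= (b * (1 - b))^-1 * (rel_entropy S u / u ^+ 2).
Proof.
move=> b0 b1 u0.
have h1 := rel_entropy_subgradient S_neq0 S_sphere (b * u) u.
have h2 := rel_entropy_ge0 S_neq0 S_sphere (b * u).
have bb : 0 < b * (1 - b) by rewrite mulr_gt0// subr_gt0.
have uu : 0 < u ^+ 2 by rewrite exprn_gt0.
rewrite -(ler_pM2l (mulr_gt0 bb uu)).
have -> : b * (1 - b) * u ^+ 2 * ((b * (1 - b))^-1 * (rel_entropy S u / u ^+ 2)) =
    rel_entropy S u.
  by field; rewrite !gt_eqF ?subr_gt0.
move: (rel_entropy S (b * u)) (rel_entropy S u) (sqmean S (b * u)) h1 h2 => e1 e2 q1.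
by lra.
Qed.

(** The subgradient inequality at b u, towards r u. The increment of G is large
    because G (b u) >= (b^2 - 1) ln M, while G (r u) <= G u + (r^2 - 1) ln M. *)
Lemma sqmean_ge_rel_entropy b r u : 1 <= r -> r < b -> 0 < u -> u ^+ 2 = 2 * ln M ->
  1 - sqmean S (b * u) <=
  (b - r) / (2 * b) + (b * (b - r))^-1 * (rel_entropy S u / u ^+ 2).
Proof.
move=> r1 rb u0 uM.
have b0 : 0 < b by lra.
have br : 0 < b * (b - r) by rewrite mulr_gt0// subr_gt0.
have uu : 0 < u ^+ 2 by rewrite exprn_gt0.
have h1 := rel_entropy_subgradient S_neq0 S_sphere (b * u) (r * u).
have h2 := rel_entropy_ge S_neq0 S_sphere (b * u).
have h3 : rel_entropy S (r * u) - rel_entropy S u <= ((r * u) ^+ 2 - u ^+ 2) / 2.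
  apply: rel_entropy_increment => //; first exact: ltW.
  by rewrite ler_peMl// ltW.
have lM : ln M = u ^+ 2 / 2 by rewrite uM; field.
rewrite lM in h2.
rewrite -subr_ge0 -(pmulr_rge0 _ (mulr_gt0 br uu)).
have -> : b * (b - r) * u ^+ 2 * ((b - r) / (2 * b) + (b * (b - r))^-1 *
    (rel_entropy S u / u ^+ 2) - (1 - sqmean S (b * u))) =
    (b - r) ^+ 2 * u ^+ 2 / 2 + rel_entropy S u - b * (b - r) * u ^+ 2 * (1 - sqmean S (b * u)).
  by field; rewrite !gt_eqF ?subr_gt0.
move: (rel_entropy S (b * u)) (rel_entropy S (r * u)) (rel_entropy S u) (sqmean S _) h1 h2 h3.
by move=> e1 e2 e3 q1; lra.
Qed.

End finite_size.

(** * Limits *)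

Lemma cvg_EFin_nearP (R : realType) (f : nat -> \bar R) (g : R^nat) (l : R) :
  (\forall N \near \oo, f N = (g N)%:E) ->
  (f N @[N --> \oo] --> l%:E <->
   forall e, 0 < e -> \forall N \near \oo, `|l - g N| <= e).
Proof.
move=> fg; split.
  move=> /fine_cvgP[_ /cvgrPdist_le H] e e0.
  by apply: filterS2 fg (H e e0) => N fN; rewrite /= fN.
move=> H; apply/fine_cvgP; split; first by apply: filterS fg => N ->.
apply/cvgrPdist_le => e e0.
by apply: filterS2 fg (H e e0) => N fN; rewrite /= fN.
Qed.

Lemma limn_esup_lt_near (R : realType) (f : nat -> \bar R) (c : \bar R) :
  (limn_esup f < c)%E -> \forall N \near \oo, (f N < c)%E.
Proof.
rewrite /limn_esup /limf_esup => /ereal_inf_lt[_ [A A_oo <-] Ac].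
apply: filterS A_oo => N AN; apply: le_lt_trans Ac.
by apply: ereal_sup_ubound; exists N.
Qed.

(** A limit that does not exist has the default value 0; the condition c < 0
    rules this out. *)
Lemma lim_left_le_near (R : realType) (f : R -> \bar R) (a : R) (c d : \bar R) :
  (lim (f t @[t --> a^'-]) <= c)%E -> (c < 0)%E -> (c < d)%E ->
  exists2 t, t < a & (f t < d)%E.
Proof.
move=> fc c0 cd.
have [cf|ncf] := pselect (cvg (f t @[t --> a^'-])); last first.
  move: fc; rewrite dvgP// => fc.
  by have := le_lt_trans fc c0; rewrite ltxx.
have fd : (lim (f t @[t --> a^'-]) < d)%E by exact: le_lt_trans cd.
have H : \forall t \near a^'-, (f t < d)%E.
  exact: (cf _ (open_ereal_lt' fd)).
have H' : \forall t \near a^'-, t < a by exact: nbhs_left_lt.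
have [t [ft ta]] := @filter_ex _ _ (at_left_proper_filter a) _ (filterI H H').
by exists t.
Qed.

Lemma ln_card_near (R : realType) (m : nat -> nat) :
  m N @[N --> \oo] --> \oo ->
  forall A : R, \forall N \near \oo, A <= ln (m N)%:R.
Proof.
move=> /(@cvgenyP R) /cvgeryP /cvgryPge H A.
apply: filterS (H (expR A)) => N HN.
by rewrite -ler_expR lnK// posrE (lt_le_trans (expR_gt0 _) HN).
Qed.

(** * The all-or-nothing phenomenon *)

Section asymptotics.
Context {R : realType} (S : forall N : nat, {fset N.-tuple R}).
Hypothesis S_sphere : forall N x, x \in S N -> dotp x x = 1.
Hypothesis S_neq0 : forall N, (0 < N)%N -> S N != fset0.
Hypothesis card_S : #|` S N| @[N --> \oo] --> \oo.

Local Notation L N := (ln #|` S N|%:R : R).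

Lemma near_S_neq0 : \forall N \near \oo, S N != fset0.
Proof. by exists 1 => // N /= N0; exact: S_neq0. Qed.

Lemma near_L_ge (A : R) : \forall N \near \oo, A <= L N.
Proof. exact: (ln_card_near card_S). Qed.

Lemma KL_cvg0P :
  ((KL (observation_law (S N) (2 * L N)) (observation_law (S N) 0)
      * ((L N)^-1)%:E @[N --> \oo] --> 0)%E) <->
  (forall e, 0 < e -> \forall N \near \oo,
     rel_entropy (S N) (Num.sqrt (2 * L N)) / L N <= e).
Proof.
rewrite (@cvg_EFin_nearP R _ (fun N => rel_entropy (S N) (Num.sqrt (2 * L N)) / L N) 0);
  last first.
  apply: filterS near_S_neq0 => N SN; rewrite EFinM; congr (_ * _)%E.
  exact: (KL_observation_law SN (@S_sphere N)).
have norm_e : \forall N \near \oo,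
    `|0 - rel_entropy (S N) (Num.sqrt (2 * L N)) / L N| =
    rel_entropy (S N) (Num.sqrt (2 * L N)) / L N.
  apply: filterS2 near_S_neq0 (near_L_ge 0) => N SN LN.
  by rewrite sub0r normrN ger0_norm// divr_ge0 ?rel_entropy_ge0//; exact: S_sphere.
by split=> H e e0; apply: filterS2 norm_e (H e e0) => N ->.
Qed.

Lemma gaussian_mmse_cvgP (lam : R^nat) (l : R) :
  gaussian_mmse (S N) (lam N) @[N --> \oo] --> l%:E <->
  (forall e, 0 < e -> \forall N \near \oo,
     `|l - (1 - sqmean (S N) (Num.sqrt (lam N)))| <= e).
Proof.
apply: cvg_EFin_nearP; apply: filterS near_S_neq0 => N SN.
by rewrite gaussian_mmseE//; exact: S_sphere.
Qed.

Lemma gaussian_mmse_cvg1P (lam : R^nat) :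
  gaussian_mmse (S N) (lam N) @[N --> \oo] --> 1%E <->
  (forall e, 0 < e -> \forall N \near \oo,
     sqmean (S N) (Num.sqrt (lam N)) <= e).
Proof.
rewrite (gaussian_mmse_cvgP lam 1).
have norm_q : \forall N \near \oo,
    `|1 - (1 - sqmean (S N) (Num.sqrt (lam N)))| = sqmean (S N) (Num.sqrt (lam N)).
  apply: filterS near_S_neq0 => N SN.
  by rewrite subKr ger0_norm// sqmean_ge0//; exact: S_sphere.
by split=> H e e0; apply: filterS2 norm_q (H e e0) => N ->.
Qed.

Lemma gaussian_mmse_cvg0P (lam : R^nat) :
  gaussian_mmse (S N) (lam N) @[N --> \oo] --> 0%E <->
  (forall e, 0 < e -> \forall N \near \oo,
     1 - sqmean (S N) (Num.sqrt (lam N)) <= e).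
Proof.
rewrite (gaussian_mmse_cvgP lam 0).
have norm_q : \forall N \near \oo,
    `|0 - (1 - sqmean (S N) (Num.sqrt (lam N)))| = 1 - sqmean (S N) (Num.sqrt (lam N)).
  apply: filterS near_S_neq0 => N SN.
  rewrite sub0r normrN ger0_norm// subr_ge0 sqmean_le1//; exact: S_sphere.
by split=> H e e0; apply: filterS2 norm_q (H e e0) => N ->.
Qed.

(** The sequence lam is tied to 2 L N only eventually, so that it can be chosen
    positive at every N. The subgradient inequality at parameters proportional
    to the square root of 2 L N gives the rates. *)
Theorem all_or_nothing_of_KL (lam : R^nat) :
  (\forall N \near \oo, lam N = 2 * L N) ->
  (forall e, 0 < e -> \forall N \near \oo,
     rel_entropy (S N) (Num.sqrt (2 * L N)) / L N <= e) ->
  all_or_nothing S lam.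
Proof.
move=> lamE small.
pose u N : R := Num.sqrt (2 * L N).
have u0 : \forall N \near \oo, 0 < u N.
  by apply: filterS (near_L_ge 1) => N LN; rewrite sqrtr_gt0 mulr_gt0// (lt_le_trans _ LN).
have uE : \forall N \near \oo, u N ^+ 2 = 2 * L N.
  by apply: filterS (near_L_ge 0) => N LN; rewrite sqr_sqrtr// mulr_ge0.
have lamu beta : 0 <= beta ->
    \forall N \near \oo, Num.sqrt (beta * lam N) = Num.sqrt beta * u N.
  by move=> b0; apply: filterS lamE => N ->; rewrite sqrtrM.
have ratio e : 0 < e -> \forall N \near \oo, rel_entropy (S N) (u N) / u N ^+ 2 <= e.
  move=> e0; apply: filterS3 (small e e0) uE (near_L_ge 1) => N eN -> LN.
  have L0 : 0 < L N by exact: lt_le_trans LN.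
  move: eN; rewrite -/(u N) !ler_pdivrMr ?mulr_gt0// => /le_trans; apply.
  by rewrite ler_wpM2l ?(ltW e0)//; lra.
have low b : 0 < b -> b < 1 -> forall e, 0 < e ->
    \forall N \near \oo, sqmean (S N) (b * u N) <= e.
  move=> b0 b1 e e0.
  have bb : 0 < b * (1 - b) by rewrite mulr_gt0// subr_gt0.
  apply: filterS3 near_S_neq0 u0 (ratio (b * (1 - b) * e) (mulr_gt0 bb e0)).
  move=> N SN uN rN; apply: le_trans (sqmean_le_rel_entropy SN (@S_sphere N) b0 b1 uN) _.
  by rewrite ler_pdivrMl.
split.
- by apply: filterS2 lamE (near_L_ge 1) => N -> LN; rewrite mulr_gt0// (lt_le_trans _ LN).
- move=> beta /andP[beta0 beta1]; apply/gaussian_mmse_cvg1P => e e0.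
  move: beta0; rewrite le_eqVlt => /predU1P[<-|beta0].
    (* At beta = 0 the subgradient inequality is void; use that the posterior
       mean is shortest there. *)
    have h0 : 0 < 2^-1 :> R by rewrite invr_gt0.
    have h1 : 2^-1 < 1 :> R by rewrite invf_lt1// ltr1n.
    apply: filterS2 near_S_neq0 (low _ h0 h1 e e0) => N SN; apply: le_trans.
    by rewrite mul0r sqrtr0; apply: sqmean_ge_sqmean0 => //; exact: S_sphere.
  have b1 : Num.sqrt beta < 1 by rewrite -sqrtr1 ltr_sqrt.
  have b0 : 0 < Num.sqrt beta by rewrite sqrtr_gt0.
  by apply: filterS2 (lamu beta (ltW beta0)) (low _ b0 b1 e e0) => N ->.
- move=> beta beta1; apply/gaussian_mmse_cvg0P => e e0.
  have beta0 : 0 <= beta by rewrite ltW// (lt_trans ltr01).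
  set b := Num.sqrt beta.
  have b1 : 1 < b by rewrite -sqrtr1 ltr_sqrt// (lt_trans ltr01).
  have b0 : 0 < b by exact: lt_trans b1.
  (* So close to b that the main error (b - r) / (2 b) is at most e / 2. *)
  pose r := Num.max 1 (b - b * e).
  have r1 : 1 <= r by rewrite le_max lexx.
  have rb : r < b by rewrite gt_max b1/= ltrBlDr ltrDl mulr_gt0.
  have br : 0 < b * (b - r) by rewrite mulr_gt0// subr_gt0.
  have rE : (b - r) / (2 * b) <= e / 2.
    have : b - b * e <= r by rewrite le_max lexx orbT.
    by rewrite ler_pdivrMr ?mulr_gt0// => ?; lra.
  have e2 : 0 < b * (b - r) * (e / 2) by rewrite !mulr_gt0 ?subr_gt0.
  apply: filterS3 (filterI near_S_neq0 uE) (filterI u0 (lamu beta beta0)) (ratio _ e2).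
  move=> N [SN uN] [uN0 ->] rN.
  apply: le_trans (sqmean_ge_rel_entropy SN (@S_sphere N) r1 rb uN0 uN) _.
  have : (b * (b - r))^-1 * (rel_entropy (S N) (u N) / u N ^+ 2) <= e / 2 by rewrite ler_pdivrMl.
  by move: (_^-1 * _) (_ / (2 * b)) rE => x y; lra.
Qed.

(** The overlap hypothesis is used once, in the Fano inequality just above the
    critical value, to bound 2 L N by a multiple of lam N close to lam N itself;
    there the divergence is still a small fraction of lam N. *)
Theorem KL_of_all_or_nothing (lam : R^nat) :
  (forall e, 0 < e -> exists2 t : R, t < 1 &
     \forall N \near \oo, ln (pair_prob (S N) t) <= (- 1 + e) * L N) ->
  all_or_nothing S lam ->
  forall e, 0 < e -> \forall N \near \oo,
     rel_entropy (S N) (Num.sqrt (2 * L N)) / L N <= e.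
Proof.
move=> overlap [lam0 nothing all] e e0.
pose u N : R := Num.sqrt (lam N).
pose eta : R := Num.min 4^-1 (e / 4).
have eta0 : 0 < eta by rewrite lt_min invr_gt0 ltr0n divr_gt0.
have eta1 : eta <= 4^-1 by rewrite ge_min lexx.
have etae : eta <= e / 4 by rewrite ge_min lexx orbT.
(* Between 1 - k and 1 + k half the square grows by 2 k = eta / 2. *)
pose k := eta / 4.
have k0 : 0 < k by rewrite divr_gt0.
have k1 : k <= 16^-1 by rewrite /k; lra.
have k1' : 0 <= 1 - k by lra.
have kk : 1 - k <= 1 + k by lra.
have fact1 x : x <= eta / 2 -> x + ((1 + k) ^+ 2 - (1 - k) ^+ 2) / 2 <= eta.
  by rewrite /k; lra.
have fact2 v l : ((1 + k) * v) ^+ 2 / 2 - l <= v ^+ 2 * eta -> v ^+ 2 <= 4 * l.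
  have v0 := sqr_ge0 v.
  have : 0 <= v ^+ 2 * k by rewrite mulr_ge0// ltW.
  have : 0 <= v ^+ 2 * k ^+ 2 by rewrite mulr_ge0// sqr_ge0.
  have : v ^+ 2 * eta <= v ^+ 2 * 4^-1 by rewrite (ler_wpM2l v0).
  by lra.
(* Small enough for (1 + k / 3) ^ 2 <= (1 - 3 d) (1 + k) ^ 2; the error d is
   spent three times: on the overlap, on ln 2 and on the mean square error. *)
pose d := k / 12.
have d0 : 0 < d by rewrite divr_gt0.
have fact3 v l x y z : - y <= ((1 + k / 3) * v) ^+ 2 / 2 + z + x ->
    x <= d * l -> z <= d * l -> y <= (- 1 + d) * l -> 2 * l <= ((1 + k) * v) ^+ 2.
  move=> Hy Hx Hz Hl.
  have d3 : 0 < 1 - 3 * d by rewrite /d; lra.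
  rewrite -(ler_pM2l d3).
  apply: (@le_trans _ _ (((1 + k / 3) * v) ^+ 2)); first by lra.
  have -> : (1 - 3 * d) * ((1 + k) * v) ^+ 2 = (1 - 3 * d) * (1 + k) ^+ 2 * v ^+ 2.
    by ring.
  rewrite exprMn (ler_wpM2r (sqr_ge0 v))//.
  have kk0 : 0 <= k ^+ 2 by rewrite sqr_ge0.
  have kk1 : k ^+ 2 <= k / 16 by rewrite expr2 (ler_wpM2l (ltW k0)).
  have kk2 : k ^+ 3 <= k / 16.
    by rewrite exprS (le_trans _ kk1)// expr2 (ler_wpM2l (ltW k0))//; lra.
  by rewrite /d; lra.
have sqrtu (b : R) N : 0 <= b -> Num.sqrt (b ^+ 2 * lam N) = b * u N.
  by move=> b0; rewrite sqrtrM ?sqr_ge0// sqrtr_sqr ger0_norm.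
have uE : \forall N \near \oo, u N ^+ 2 = lam N.
  by apply: filterS lam0 => N lN; rewrite sqr_sqrtr// ltW.
have q1 : \forall N \near \oo, sqmean (S N) ((1 - k) * u N) <= eta / 2.
  have bb : 0 <= (1 - k) ^+ 2 < 1 by rewrite sqr_ge0/= expr_lt1//; lra.
  have := nothing _ bb => /gaussian_mmse_cvg1P /(_ _ (divr_gt0 eta0 (ltr0n _ 2))).
  by apply: filterS => N; rewrite sqrtu.
have [t t1 Pt] := overlap d d0.
have q2 : \forall N \near \oo, 1 - sqmean (S N) ((1 + k / 3) * u N) <= d * (1 - t).
  have k3 : 1 < 1 + k / 3 by lra.
  have bb : 1 < (1 + k / 3) ^+ 2 by rewrite exprn_egt1.
  have td : 0 < d * (1 - t) by rewrite mulr_gt0// subr_gt0.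
  have := all _ bb => /gaussian_mmse_cvg0P /(_ _ td).
  by apply: filterS => N; rewrite sqrtu//; lra.
apply: filterS3 (filterI near_S_neq0 (filterI q1 q2)) (filterI uE (filterI Pt lam0))
  (filterI (near_L_ge 1) (near_L_ge (ln 2 / d))).
move=> N [SN [q1N q2N]] [uN [PN lN]] [LN LN2].
have sph := @S_sphere N.
have uN0 : 0 <= u N by exact: sqrtr_ge0.
have uu0 : 0 < u N ^+ 2 by rewrite uN.
have L0 : 0 < L N by exact: lt_le_trans LN.
have eb : rel_entropy (S N) ((1 + k) * u N) <= u N ^+ 2 * eta.
  apply: le_trans (rel_entropy_le_sqmean SN sph uN0 k1' kk) _.
  rewrite (ler_wpM2l (ltW uu0))//; apply: fact1.
  apply: le_trans q1N; rewrite ler_piMl ?sqmean_ge0// expr_le1//.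
  by rewrite gerBl ltW.
have uL : u N ^+ 2 <= 4 * L N.
  by apply: fact2; exact: le_trans (rel_entropy_ge SN sph _) eb.
have LU : 2 * L N <= ((1 + k) * u N) ^+ 2.
  apply: fact3 (ln_pair_prob_ge SN sph ((1 + k / 3) * u N) t1) _ _ PN.
    rewrite [leRHS]mulrC mulrAC -mulrA (ler_wpM2l (ltW L0))//.
    by rewrite ler_pdivrMr ?subr_gt0.
  by rewrite mulrC -ler_pdivrMr.
have su : Num.sqrt (2 * L N) <= (1 + k) * u N.
  rewrite -[leRHS]ger0_norm; last by rewrite mulr_ge0// addr_ge0// ltW.
  by rewrite -sqrtr_sqr ler_wsqrtr.
have := le_trans (rel_entropy_le SN sph (sqrtr_ge0 _) su) eb.
rewrite ler_pdivrMr//; move=> /le_trans; apply.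
apply: (@le_trans _ _ (4 * L N * eta)); first by rewrite ler_wpM2r// ltW.
by rewrite mulrAC (ler_wpM2r (ltW L0))// mulrC -ler_pdivlMr.
Qed.

End asymptotics.

Theorem theorem1 (R : realType) (S : forall N : nat, {fset N.-tuple R})
  (S_sphere : forall N x, x \in S N -> Num.sqrt (dotp x x) = 1)
  (S_neq0 : forall N, (0 < N)%N -> S N != fset0)
  (card_S : #|` S N| @[N --> \oo] --> \oo)
  (overlap :
     (lim (limn_esup (fun N =>
             ((ln #|` S N|%:R)^-1)%:E *
             lne ((uniform_law (S N) \x uniform_law (S N))
                    [set xx | (t <= dotp xx.1 xx.2)%R]))
           @[t --> (1 : R)^'-])
      <= (-1)%:E)%E) :
  ((exists lambda : R^nat,
      (forall N, 0 < lambda N) /\ all_or_nothing S lambda) <->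
   (KL (observation_law (S N) (2 * ln #|` S N|%:R)) (observation_law (S N) 0)
      * ((ln #|` S N|%:R)^-1)%:E @[N --> \oo] --> 0)%E) /\
  ((KL (observation_law (S N) (2 * ln #|` S N|%:R)) (observation_law (S N) 0)
      * ((ln #|` S N|%:R)^-1)%:E @[N --> \oo] --> 0)%E ->
   all_or_nothing S (fun N => 2 * ln #|` S N|%:R)).
Proof.
have sph N x : x \in S N -> dotp x x = 1.
  move=> /S_sphere s1.
  have d0 : 0 <= dotp x x by apply: sumr_ge0 => i _; rewrite -expr2 sqr_ge0.
  by rewrite -(sqr_sqrtr d0) s1 expr1n.
have KLP := KL_cvg0P sph S_neq0 card_S.
have backward lam : (\forall N \near \oo, lam N = 2 * ln #|` S N|%:R) ->
    (KL (observation_law (S N) (2 * ln #|` S N|%:R)) (observation_law (S N) 0)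
      * ((ln #|` S N|%:R)^-1)%:E @[N --> \oo] --> 0)%E -> all_or_nothing S lam.
  by move=> lamE /KLP; exact: all_or_nothing_of_KL.
split; last by apply: backward; exact: nearW.
split.
  move=> [lam [_ aon]]; apply/KLP; apply: (KL_of_all_or_nothing sph S_neq0 card_S _ aon).
  move=> e e0.
  have m1 : ((-1)%:E < 0 :> \bar R)%E by rewrite lte_fin oppr_lt0.
  have m1e : ((-1)%:E < (-1 + e)%:E :> \bar R)%E by rewrite lte_fin ltrDl.
  have [t t1 /limn_esup_lt_near H] := lim_left_le_near overlap m1 m1e.
  exists t => //.
  apply: filterS3 H (near_S_neq0 S_neq0) (near_L_ge card_S 1) => N HN SN LN.
  have L0 : 0 < ln #|` S N|%:R :> R by exact: lt_le_trans LN.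
  have P0 : 0 < pair_prob (S N) t := pair_prob_gt0 SN (@sph N) (ltW t1).
  move: HN; rewrite (pair_probE SN) lne_EFin//.
  by rewrite -EFinM lte_fin ltr_pdivrMl// mulrC => /ltW.
move=> KL0.
pose lam N : R := if 0 < 2 * ln #|` S N|%:R :> R then 2 * ln #|` S N|%:R else 1.
exists lam; split; first by move=> N; rewrite /lam; case: ifPn.
apply: backward => //; apply: filterS (near_L_ge card_S 1) => N LN.
by rewrite /lam ifT// mulr_gt0// (lt_le_trans _ LN).
Qed.
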